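(* Let $N\ge 2$ be an integer. For every $\alpha\in[0,N)$ and every $Q>0$, the problem $$\min\left\{P(E)+Q^2\,\mathcal I_\alpha(E)\ :\ E\subset\mathbb R^N \text{ convex body},\ |E|=1\right\}$$ admits a minimizer.
   Context: A convex body is a compact convex subset of $\mathbb R^N$ with nonempty interior; $|E|$ is its Lebesgue measure and $P(E):=\mathcal H^{N-1}(\partial E)$ its perimeter. Letting $\mathcal P(E)$ be the set of Borel probability measures supported on the closure of $E$, set, for $\alpha\in(0,N)$, $$\mathcal I_\alpha(E):=\inf_{\mu\in\mathcal P(E)}\int_{E\times E}\frac{d\mu(x)\,d\mu(y)}{|x-y|^\alpha},$$ and, for $\alpha=0$, $$\mathcal I_0(E):=\inf_{\mu\in\mathcal P(E)}\int_{E\times E}\log\left(\frac1{|x-y|}\right)d\mu(x)\,d\mu(y).$$ *)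

(* Defs.v *)
From HB Require Import structures.
From mathcomp Require Import all_boot all_order all_algebra.
From mathcomp Require Import all_classical all_reals all_analysis.
Import Order.TTheory GRing.Theory Num.Theory.
Import numFieldNormedType.Exports.

Set Implicit Arguments.
Unset Strict Implicit.
Unset Printing Implicit Defensive.

Local Open Scope classical_set_scope.
Local Open Scope ring_scope.

(* The library norm `|x| on 'rV[R]_n is the sup norm.  It induces the Euclidean
   topology, so [compact], [interior], [closure] and [open] below are the usual
   notions, but distances must be measured with [edist]. *)
Definition enorm (R : realType) (n : nat) (x : 'rV[R]_n) : R :=
  Num.sqrt (\sum_(i < n) x ord0 i ^+ 2).

Definition edist (R : realType) (n : nat) (x y : 'rV[R]_n) : R :=
  enorm (x - y).

Definition convex_body (R : realType) (n : nat) (E : set 'rV[R]_n) : Prop :=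
  [/\ compact E, convex_set E & interior E !=set0].

Definition box (R : realType) (n : nat) (a b : 'rV[R]_n) : set 'rV[R]_n :=
  [set x | forall i, a ord0 i <= x ord0 i <= b ord0 i].

(* Lebesgue outer measure on R^n, which is Lebesgue measure on measurable
   sets and in particular on compact ones.  The index set [D] makes finite
   covers admissible, including in dimension 0. *)
Definition volume (R : realType) (n : nat) (A : set 'rV[R]_n) : \bar R :=
  ereal_inf [set v | exists (D : set nat) (a b : nat -> 'rV[R]_n),
    [/\ forall j i, a j ord0 i <= b j ord0 i,
        A `<=` \bigcup_(j in D) box (a j) (b j) &
        v = (\esum_(j in D) (\prod_(i < n) (b j ord0 i - a j ord0 i))%:E)%E]].

(* The added 0 only matters for the empty set, whose diameter is 0. *)
Definition diam (R : realType) (n : nat) (U : set 'rV[R]_n) : \bar R :=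
  ereal_sup (0%E |` [set (edist p.1 p.2)%:E | p in U `*` U]).

Definition unit_ball_volume (R : realType) (k : nat) : \bar R :=
  volume [set x : 'rV[R]_k | enorm x <= 1].

Definition hausdorff_premeasure (R : realType) (n k : nat) (delta : R)
    (A : set 'rV[R]_n) : \bar R :=
  ereal_inf [set v | exists (D : set nat) (U : nat -> set 'rV[R]_n),
    [/\ forall j, (diam (U j) <= delta%:E)%E,
        A `<=` \bigcup_(j in D) U j &
        v = (\esum_(j in D)
              (unit_ball_volume R k * (2^-1%:E * diam (U j)) ^+ k))%E]].

(* k-dimensional Hausdorff (outer) measure, normalized so that it agrees with
   Lebesgue measure on R^k; the supremum is the limit as delta -> 0+. *)
Definition hausdorff_measure (R : realType) (n k : nat) (A : set 'rV[R]_n) :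
    \bar R :=
  ereal_sup [set hausdorff_premeasure k delta A | delta in [set d : R | 0 < d]].

Definition perimeter (R : realType) (n : nat) (E : set 'rV[R]_n) : \bar R :=
  hausdorff_measure n.-1 (closure E `\` interior E).

Definition borel (R : realType) (n : nat) :=
  g_sigma_algebraType (@open 'rV[R]_n).

Definition supported_probability (R : realType) (n : nat) (E : set 'rV[R]_n) :
    set (probability (borel R n) R) :=
  [set mu | mu (~` closure E) = 0%E].

(* The value on the diagonal has to be set to +oo explicitly, since in the
   library 0^-1 = 0 and ln 0 = 0. *)
Definition riesz_kernel (R : realType) (n : nat) (alpha : R) (x y : 'rV[R]_n) :
    \bar R :=
  if x == y then +oo%E
  else if alpha == 0 then (ln (1 / edist x y))%:E
  else (1 / (edist x y `^ alpha))%:E.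

Definition energy (R : realType) (n : nat) (alpha : R) (E : set 'rV[R]_n) :
    \bar R :=
  ereal_inf
    [set (\int[mu \x mu]_(p in (E `*` E)) riesz_kernel alpha p.1 p.2)%E
       | mu in supported_probability E].

Definition functional (R : realType) (n : nat) (alpha Q : R)
    (E : set 'rV[R]_n) : \bar R :=
  (perimeter E + (Q ^+ 2)%:E * energy alpha E)%E.

(* Main.v *)
(* Neither compactness of measures nor an isoperimetric inequality is needed.

   Both terms are monotone and homogeneous: the energy decreases when the set
   grows, and the perimeter increases with the convex body, because the nearest
   point projection onto the smaller body is 1-Lipschitz and maps the boundary of
   the larger one onto that of the smaller one.  Hence, if translates of bodies
   [F_k] and a body [E] satisfy [E / c <= F_k <= c E], then the perimeter, energy
   and volume of [E] are controlled by those of [F_k] up to factors tending to 1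
   as [c] decreases to 1, which gives lower semicontinuity.

   For the compactness of minimizing sequences, let [|E| = 1] and [P(E) <= p].
   Sliding the points of [E] along a coordinate direction to the boundary shows
   that [|E| <= C w P(E)] when all chords of [E] in that direction have length at
   most [w]; so [E] has a chord of length of order [1 / p] in every coordinate
   direction, and averaging these chords yields a cube of side of order [1 / p]
   in [E].  The disjoint half-size cubes on the segment from its center to a far
   point of [E] have total volume at most 1, so the diameter of [E] is
   [O(p ^ N)]; as the energy is at least [- ln (diameter)], a bound on the
   functional bounds [p].  Blaschke selection is then done along an
   ultrafilter. *)
From HB Require Import structures.
From mathcomp Require Import all_boot all_order all_algebra.
From mathcomp Require Import all_classical all_reals all_analysis.
From mathcomp Require Import measurable_realfun ring lra.
Require Import Defs.
Import Order.TTheory GRing.Theory Num.Theory.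
Import numFieldNormedType.Exports.

Set Implicit Arguments.
Unset Strict Implicit.
Unset Printing Implicit Defensive.

Local Open Scope classical_set_scope.
Local Open Scope ring_scope.

(** * Boxes and outer volume *)

Section volume_lower_bound.
Context {R : realType}.
Local Notation mu := (@lebesgue_measure R).

Lemma esumZl (D : set nat) (c : R) (a : nat -> \bar R) : 0 <= c ->
  (forall j, D j -> (0 <= a j)%E) ->
  (\esum_(j in D) (c%:E * a j) = c%:E * \esum_(j in D) a j)%E.
Proof.
move=> c0 a0; rewrite esum_mkcond [in RHS]esum_mkcond.
have pos j : (0 <= if j \in D then a j else 0)%E.
  by case: ifPn => // /set_mem /a0.
rewrite -!nneseries_esumT//; last first.
  by move=> j; case: ifPn => // /set_mem Dj; rewrite mule_ge0// a0.
rewrite -nneseriesZl//.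
by apply: eq_eseriesr => j _; case: ifPn => //; rewrite mule0.
Qed.

Definition slab (a b t : R) : R := (a <= t <= b)%R%:R.

Lemma slabE a b : slab a b = \1_`[a, b].
Proof.
by apply/funext => t; rewrite /slab indicE; congr (nat_of_bool _)%:R; apply/idP/idP;
  rewrite inE/= in_itv.
Qed.

Lemma measurable_scaled_slab c a b :
  measurable_fun [set: R] (EFin \o (fun t => c * slab a b t)).
Proof.
by apply/measurable_EFinP/measurable_funM => //; rewrite slabE; exact: measurable_indic.
Qed.

Lemma integral_scaled_slab c a b : 0 <= c -> a <= b ->
  (\int[mu]_t (c * slab a b t)%:E = (c * (b - a))%:E)%E.
Proof.
move=> c0 ab; under eq_integral do rewrite EFinM.
rewrite ge0_integralZl_EFin//; last 2 first.
- by move=> x _; rewrite lee_fin /slab.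
- by apply/measurable_EFinP; rewrite slabE; exact: measurable_indic.
rewrite slabE integral_indic// setIT /= lebesgue_measure_itv/= lte_fin EFinM.
move: ab; rewrite le_eqVlt => /orP[/eqP->|ab].
  by rewrite ltxx subrr.
by rewrite ab EFinB.
Qed.

(* Fubini one coordinate at a time: in the first [k] coordinates the indicator
   of the box has already been integrated. *)
Definition box_section n k (a b x : 'rV[R]_n) : R :=
  \prod_(i < n) (if (i < k)%N then b ord0 i - a ord0 i
                 else slab (a ord0 i) (b ord0 i) (x ord0 i)).

Definition set_coord n (x : 'rV[R]_n) (k : 'I_n) (t : R) : 'rV[R]_n :=
  \row_i (if i == k then t else x ord0 i).

Lemma box_section_ge0 n k (a b x : 'rV[R]_n) :
  (forall i, a ord0 i <= b ord0 i) -> 0 <= box_section k a b x.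
Proof.
move=> ab; apply: prodr_ge0 => i _; case: ifP => _; first by rewrite subr_ge0.
by rewrite /slab.
Qed.

Lemma box_section_slab n (k : 'I_n) (a b x : 'rV[R]_n) :
  (forall i, a ord0 i <= b ord0 i) ->
  exists2 c, 0 <= c & box_section k.+1 a b x = c * (b ord0 k - a ord0 k) /\
    forall t, box_section k a b (set_coord x k t) = c * slab (a ord0 k) (b ord0 k) t.
Proof.
move=> ab; exists (\prod_(i < n | i != k) (if (i < k)%N then b ord0 i - a ord0 i
                 else slab (a ord0 i) (b ord0 i) (x ord0 i))).
  apply: prodr_ge0 => i _; case: ifP => _; first by rewrite subr_ge0.
  by rewrite /slab.
split=> [|t]; rewrite /box_section (bigD1 k)//= mulrC.
  rewrite ltnSn; congr (_ * _); apply: eq_bigr => i ik.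
  by rewrite ltnS leq_eqVlt (negbTE ik : (val i == val k) = false).
rewrite ltnn mxE eqxx; congr (_ * _); apply: eq_bigr => i ik.
by rewrite mxE (negbTE ik).
Qed.

Lemma integral_box_section n (k : 'I_n) (w : R) (a b x : 'rV[R]_n) :
  0 <= w -> (forall i, a ord0 i <= b ord0 i) ->
  (\int[mu]_t (w * box_section k a b (set_coord x k t))%:E =
   (w * box_section k.+1 a b x)%:E)%E.
Proof.
move=> w0 ab; have [c c0 [-> E]] := box_section_slab k x ab.
under eq_integral do rewrite E mulrA.
by rewrite integral_scaled_slab ?mulr_ge0// mulrA.
Qed.

Lemma measurable_box_section n (k : 'I_n) (w : R) (a b x : 'rV[R]_n) :
  (forall i, a ord0 i <= b ord0 i) ->
  measurable_fun [set: R]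
    (EFin \o (fun t => w * box_section k a b (set_coord x k t))).
Proof.
move=> ab; have [c c0 [_ E]] := box_section_slab k x ab.
under eq_fun do rewrite E mulrA.
exact: measurable_scaled_slab.
Qed.

(** Induction on [k]: integrating in coordinate [k] replaces an indicator factor by a side length,
    so an inequality between indicators becomes, at [k = n], one between volumes. *)
Lemma le_box_sections n M (a' b' : 'I_M -> 'rV[R]_n) (w : nat -> R)
    (a b : nat -> 'rV[R]_n) :
  (forall m i, a' m ord0 i <= b' m ord0 i) ->
  (forall j i, a j ord0 i <= b j ord0 i) -> (forall j, 0 <= w j) ->
  (forall x, \sum_(m < M) (box_section 0 (a' m) (b' m) x)%:E <=
     \sum_(j <oo) (w j * box_section 0 (a j) (b j) x)%:E)%E ->
  forall k, (k <= n)%N ->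
  (forall x, \sum_(m < M) (box_section k (a' m) (b' m) x)%:E <=
     \sum_(j <oo) (w j * box_section k (a j) (b j) x)%:E)%E.
Proof.
move=> ab' ab w0 H0; elim=> [//|k IH] kn x; have {}IH := IH (ltnW kn).
pose K := Ordinal kn.
have mf m : measurable_fun [set: R]
    (EFin \o (fun t => box_section k (a' m) (b' m) (set_coord x K t))).
  by have := measurable_box_section K 1 x (ab' m); under eq_fun do rewrite mul1r.
have -> : (\sum_(m < M) (box_section k.+1 (a' m) (b' m) x)%:E =
    \int[mu]_t \sum_(m < M) (box_section k (a' m) (b' m) (set_coord x K t))%:E)%E.
  rewrite ge0_integral_sum//; last first.
    by move=> m t _; rewrite lee_fin box_section_ge0.
  apply: eq_bigr => m _; rewrite -[box_section _ _ _ x]mul1r.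
  rewrite -(integral_box_section K)//.
  by apply: eq_integral => t _; rewrite mul1r.
have -> : (\sum_(j <oo) (w j * box_section k.+1 (a j) (b j) x)%:E =
    \int[mu]_t \sum_(j <oo) (w j * box_section k (a j) (b j) (set_coord x K t))%:E)%E.
  rewrite integral_nneseries//; last 2 first.
  - by move=> j; exact: (measurable_box_section K).
  - by move=> j t _; rewrite lee_fin mulr_ge0// box_section_ge0.
  by apply: eq_eseriesr => j _; rewrite (integral_box_section K).
apply: ge0_le_integral => //.
- by move=> t _; apply: sume_ge0 => m _; rewrite lee_fin box_section_ge0.
- by apply: emeasurable_sum => m; exact: mf.
- apply: ge0_emeasurable_sum => //.
  + by move=> j t _ _; rewrite lee_fin mulr_ge0// box_section_ge0.
  + by move=> j _; exact: (measurable_box_section K).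
Qed.

Lemma box_section0 n (a b x : 'rV[R]_n) :
  box_section 0 a b x = (x \in box a b)%:R.
Proof.
rewrite /box_section; case: (boolP (x \in box a b)) => [/set_mem xab|].
  by rewrite big1// => i _; rewrite /slab xab.
rewrite notin_setE => /existsNP[i xi].
by rewrite (bigD1 i)//= /slab (introF idP xi) mul0r.
Qed.

Lemma box_section_full n (a b x : 'rV[R]_n) :
  box_section n a b x = \prod_(i < n) (b ord0 i - a ord0 i).
Proof. by apply: eq_bigr => i _; rewrite ltn_ord. Qed.

(** The indicators of the disjoint boxes sum to at most that of [A], hence to at most the sum over
    any cover of [A]; integrating coordinate by coordinate compares the volumes. *)
Lemma packing_le_volume n M (a' b' : 'I_M -> 'rV[R]_n) (A : set 'rV[R]_n) :
  (forall m i, a' m ord0 i <= b' m ord0 i) ->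
  (forall m, box (a' m) (b' m) `<=` A) ->
  (forall m m' x, box (a' m) (b' m) x -> box (a' m') (b' m') x -> m = m') ->
  (\sum_(m < M) (\prod_(i < n) (b' m ord0 i - a' m ord0 i))%:E <= volume A)%E.
Proof.
move=> ab' subA disj; apply: le_ereal_inf_tmp => _ [D [a [b [ab AD ->]]]].
rewrite esum_mkcond -nneseries_esumT; last first.
  by move=> j; case: ifP => // _; rewrite lee_fin prodr_ge0// => i _; rewrite subr_ge0.
(* These 0-1 weights turn the sum over [D] into a series over all indices. *)
pose w (j : nat) : R := (j \in D)%:R.
have w0 j : 0 <= w j by rewrite /w.
have base (x : 'rV[R]_n) : (\sum_(m < M) (box_section 0 (a' m) (b' m) x)%:E <=
    \sum_(j <oo) (w j * box_section 0 (a j) (b j) x)%:E)%E.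
  have pos j : (0 <= (w j * box_section 0 (a j) (b j) x)%:E)%E.
    by rewrite lee_fin mulr_ge0// box_section_ge0.
  have [[m xm]|nx] := pselect (exists m, box (a' m) (b' m) x); last first.
    rewrite big1 ?nneseries_ge0// => m _; rewrite box_section0.
    case: (boolP (x \in _)) => // /set_mem xm.
    by exfalso; apply: nx; exists m.
  rewrite (bigD1 m)//= big1 ?adde0; last first.
    move=> m' m'm; rewrite box_section0; case: (boolP (x \in _)) => // /set_mem xm'.
    by rewrite (disj _ _ _ xm xm') eqxx in m'm.
  rewrite box_section0 mem_set//.
  have [j Dj xj] := AD _ (subA m _ xm).
  apply: le_trans (nneseries_lim_ge j.+1 (fun i _ _ => pos i)).
  rewrite big_nat_recr//= box_section0 /w !mem_set// mul1r leeDr//.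
  by apply: sume_ge0 => i _; exact: pos.
(* At [k = n] the sections no longer depend on the point, here taken to be 0. *)
have := le_box_sections ab' ab w0 base (leqnn n) 0.
under eq_bigr do rewrite box_section_full.
move=> /le_trans; apply; rewrite le_eqVlt; apply/orP; left; apply/eqP.
apply: eq_eseriesr => j _; rewrite box_section_full /w.
by case: ifP => _; rewrite ?mul1r// mul0r.
Qed.

Lemma box_le_volume n (a b : 'rV[R]_n) (A : set 'rV[R]_n) :
  (forall i, a ord0 i <= b ord0 i) -> box a b `<=` A ->
  ((\prod_(i < n) (b ord0 i - a ord0 i))%:E <= volume A)%E.
Proof.
move=> ab abA.
have := @packing_le_volume n 1 (fun=> a) (fun=> b) A (fun=> ab) (fun=> abA).
rewrite big_ord1; apply=> m m' _ _ _.
by rewrite !ord1.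
Qed.

Lemma volume_le_box n (a b : 'rV[R]_n) (A : set 'rV[R]_n) :
  (forall i, a ord0 i <= b ord0 i) -> A `<=` box a b ->
  (volume A <= (\prod_(i < n) (b ord0 i - a ord0 i))%:E)%E.
Proof.
move=> ab Aab; apply: ereal_inf_lbound; exists [set 0%N], (fun=> a), (fun=> b).
split=> //; first by move=> x Ax; exists 0%N => //; exact: Aab.
rewrite esum_set1// lee_fin prodr_ge0// => i _; by rewrite subr_ge0.
Qed.

(** The map [x -> c x + v] carries a box cover of [E] to one of [F] and multiplies each box volume
    by [c ^ n]. *)
Lemma volume_affine n (c : R) (v : 'rV[R]_n) (E F : set 'rV[R]_n) : 0 < c ->
  (forall x, F x -> E (c^-1 *: (x - v))) ->
  (volume F <= (c ^+ n)%:E * volume E)%E.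
Proof.
move=> c0 FE; have cn : 0 < c ^+ n by rewrite exprn_gt0.
rewrite muleC -lee_pdivrMr//; apply: le_ereal_inf_tmp => _ [D [a [b [ab ED ->]]]].
rewrite lee_pdivrMr// muleC -esumZl ?(ltW cn)//; last first.
  by move=> j _; rewrite lee_fin prodr_ge0// => i _; rewrite subr_ge0.
apply: ereal_inf_lbound.
exists D, (fun j => c *: a j + v), (fun j => c *: b j + v); split.
- by move=> j i; rewrite !mxE lerD2r ler_pM2l.
- move=> x /FE /ED [j Dj xj]; exists j => // i; have := xj i.
  by rewrite !mxE ler_pdivlMl// ler_pdivrMl// lerBrDr lerBlDr.
- apply: eq_esum => j _; rewrite -EFinM; congr EFin.
  rewrite -[X in c ^+ X](card_ord n) -prodr_const -big_split/=.
  by apply: eq_bigr => i _; rewrite !mxE; ring.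
Qed.

End volume_lower_bound.

(** * Euclidean norm and Hausdorff measure *)

Section euclid.
Context {R : realType} {n : nat}.
Implicit Types x y z u v : 'rV[R]_n.

Lemma entry_le_norm x i : `|x ord0 i| <= `|x|.
Proof.
have /mapP[j Hj ->] : `|x ord0 i| \in [seq `|x k.1 k.2| | k : 'I_1 * 'I_n].
  by apply/mapP; exists (ord0, i) => //=; rewrite mem_enum.
by rewrite [leRHS]/Num.norm /= mx_normrE; apply/bigmax_geP; right => /=; exists j.
Qed.

Lemma norm_leP x e : 0 <= e -> (forall i, `|x ord0 i| <= e) <-> `|x| <= e.
Proof.
move=> e0; split=> [xe|xe i]; last exact: le_trans (entry_le_norm x i) xe.
rewrite /Num.norm /= mx_normrE; apply/bigmax_leP; split=> // -[i j] _ /=.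
by rewrite (ord1 i).
Qed.

Definition dot x y : R := \sum_(i < n) x ord0 i * y ord0 i.

Lemma dotC x y : dot x y = dot y x.
Proof. by apply: eq_bigr => i _; rewrite mulrC. Qed.

Lemma dotDl x y z : dot (x + y) z = dot x z + dot y z.
Proof. by rewrite -big_split; apply: eq_bigr => i _; rewrite !mxE mulrDl. Qed.

Lemma dotZl (c : R) x z : dot (c *: x) z = c * dot x z.
Proof. by rewrite /dot mulr_sumr; apply: eq_bigr => i _; rewrite !mxE mulrA. Qed.

Lemma dotNl x z : dot (- x) z = - dot x z.
Proof. by rewrite -scaleN1r dotZl mulN1r. Qed.

Lemma dotDr x y z : dot z (x + y) = dot z x + dot z y.
Proof. by rewrite dotC dotDl !(dotC z). Qed.

Lemma dotNr x z : dot z (- x) = - dot z x.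
Proof. by rewrite dotC dotNl dotC. Qed.

Lemma dotZr (c : R) x z : dot z (c *: x) = c * dot z x.
Proof. by rewrite dotC dotZl dotC. Qed.

Definition dotE := (dotDl, dotDr, dotNl, dotNr, dotZl, dotZr).

Lemma dotxx_ge0 x : 0 <= dot x x.
Proof. by apply: sumr_ge0 => i _; rewrite -expr2 sqr_ge0. Qed.

Lemma enormE x : enorm x = Num.sqrt (dot x x).
Proof. by rewrite /enorm; congr Num.sqrt; apply: eq_bigr => i _; rewrite expr2. Qed.

Lemma enorm_ge0 x : 0 <= enorm x.
Proof. exact: sqrtr_ge0. Qed.

Lemma edist_ge0 x y : 0 <= edist x y.
Proof. exact: enorm_ge0. Qed.

Lemma enormZ (c : R) x : 0 <= c -> enorm (c *: x) = c * enorm x.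
Proof.
move=> c0; rewrite !enormE dotZl dotZr mulrA -expr2 sqrtrM ?sqr_ge0//.
by rewrite sqrtr_sqr ger0_norm.
Qed.

Lemma norm_le_enorm x : `|x| <= enorm x.
Proof.
apply/norm_leP => [|i]; first exact: enorm_ge0.
rewrite -sqrtr_sqr ler_sqrt; last by apply: sumr_ge0 => j _; rewrite sqr_ge0.
by rewrite (bigD1 i)//= lerDl sumr_ge0// => j _; rewrite sqr_ge0.
Qed.

Lemma enorm_le_norm x : enorm x <= n%:R * `|x|.
Proof.
have H0 : 0 <= n%:R * `|x| by rewrite mulr_ge0.
rewrite -[leRHS]ger0_norm// -sqrtr_sqr ler_sqrt ?sqr_ge0//.
apply: (@le_trans _ _ (\sum_(i < n) `|x| ^+ 2)).
  apply: ler_sum => i _; rewrite -[leLHS]ger0_norm ?sqr_ge0// normrX.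
  by rewrite lerXn2r ?nnegrE// entry_le_norm.
rewrite sumr_const card_ord exprMn -[leLHS]mulr_natl ler_wpM2r ?sqr_ge0//.
case: (n) => [|k]; first by rewrite expr0n.
by rewrite expr2 ler_peMr// ler1n.
Qed.

End euclid.

(** * Hausdorff measure under Lipschitz maps *)

Section hausdorff.
Context {R : realType}.

Lemma volume_ge0 n (A : set 'rV[R]_n) : (0 <= volume A)%E.
Proof.
apply: le_ereal_inf_tmp => _ [D [a [b [ab _ ->]]]]; apply: esum_ge0 => j _.
by rewrite lee_fin prodr_ge0// => i _; rewrite subr_ge0.
Qed.

Lemma diam_ge0 n (U : set 'rV[R]_n) : (0 <= diam U)%E.
Proof. by apply: ereal_sup_ubound; left. Qed.

Lemma edist_le_diam n (U : set 'rV[R]_n) x y : U x -> U y ->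
  ((edist x y)%:E <= diam U)%E.
Proof. by move=> Ux Uy; apply: ereal_sup_ubound; right; exists (x, y). Qed.

Lemma diam_fin n (U : set 'rV[R]_n) delta : (diam U <= delta%:E)%E ->
  exists2 d, 0 <= d & diam U = d%:E.
Proof.
move=> Ud; have := diam_ge0 U; have : diam U \is a fin_num.
  by rewrite ge0_fin_numE ?diam_ge0// (le_lt_trans Ud)// ltry.
by move=> /fineK <-; rewrite lee_fin => d0; exists (fine (diam U)).
Qed.

Lemma hausdorff_premeasure_ge0 n k delta (A : set 'rV[R]_n) :
  (0 <= hausdorff_premeasure k delta A)%E.
Proof.
apply: le_ereal_inf_tmp => _ [D [U [_ _ ->]]]; apply: esum_ge0 => j _.
by rewrite mule_ge0 ?volume_ge0// expe_ge0// mule_ge0 ?diam_ge0.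
Qed.

Lemma hausdorff_measure_ge0 n k (A : set 'rV[R]_n) :
  (0 <= hausdorff_measure k A)%E.
Proof.
apply: le_trans (hausdorff_premeasure_ge0 k 1 A) _.
by apply: ereal_sup_ubound; exists 1 => /=.
Qed.

(** The images under [f] of a cover of [A] cover [B], and diameters grow by at most the factor [L];
    hence the scale [delta] for [B] is compared with [delta / L] for [A]. *)
Lemma hausdorff_lipschitz n m k (f : 'rV[R]_n -> 'rV[R]_m) (L : R)
    (A : set 'rV[R]_n) (B : set 'rV[R]_m) : 0 < L ->
  (forall x y, edist (f x) (f y) <= L * edist x y) -> B `<=` f @` A ->
  (hausdorff_measure k B <= (L ^+ k)%:E * hausdorff_measure k A)%E.
Proof.
move=> L0 fL BfA; have Lk : 0 < L ^+ k by rewrite exprn_gt0.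
apply: ge_ereal_sup => _ [delta /= delta0 <-].
apply: (@le_trans _ _ ((L ^+ k)%:E * hausdorff_premeasure k (L^-1 * delta) A)%E).
  rewrite muleC -lee_pdivrMr//; apply: le_ereal_inf_tmp => _ [D [U [Ud AU ->]]].
  rewrite lee_pdivrMr// muleC -esumZl ?(ltW Lk)//; last first.
    move=> j _.
    by rewrite mule_ge0 ?volume_ge0// expe_ge0// mule_ge0 ?diam_ge0.
  have dU j : (diam (f @` U j) <= L%:E * diam (U j))%E.
    apply: ge_ereal_sup => _ [->|[[x y] [[x' Ux' <-] [y' Uy' <-]] <-]].
      by rewrite mule_ge0 ?diam_ge0// lee_fin ltW.
    apply: (@le_trans _ _ (L%:E * (edist x' y')%:E)%E).
      by rewrite -EFinM lee_fin.
    by rewrite lee_pmul2l// edist_le_diam.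
  apply: (@le_trans _ _ (\esum_(j in D)
      (unit_ball_volume R k * (2^-1%:E * diam (f @` U j)) ^+ k))%E).
    apply: ereal_inf_lbound; exists D, (fun j => f @` U j); split=> //.
      move=> j; apply: le_trans (dU j) _.
      by rewrite -[delta](mulVKf (lt0r_neq0 L0)) EFinM lee_pmul2l.
    by move=> x /BfA[y /AU[j Dj Uy] <-]; exists j => //; exists y.
  apply: le_esum => j _; rewrite muleCA; apply: lee_wpmul2l; first exact: volume_ge0.
  have [d d0 E] := diam_fin (Ud j); have := dU j; rewrite E.
  move=> dU'; have [d' d'0 E'] := diam_fin dU'; rewrite E'.
  move: dU'; rewrite E' -!EFinM !lee_fin => d'd.
  rewrite -!EFin_expe -EFinM lee_fin -exprMn lerXn2r ?nnegrE ?mulr_ge0 ?(ltW L0)//.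
  by rewrite mulrCA ler_pM2l.
rewrite lee_pmul2l//; apply: ereal_sup_ubound; exists (L^-1 * delta) => //=.
by rewrite mulr_gt0 ?invr_gt0.
Qed.

End hausdorff.

(** * Projections and monotonicity of the perimeter *)

Section topology_in_norm.
Context {R : realType} {V : normedModType R}.
Implicit Types (A : set V) (x y : V).

Lemma closureP A x :
  closure A x <-> forall e, 0 < e -> exists2 y, A y & `|x - y| < e.
Proof.
split=> [clA e e0|H B /nbhs_ballP[e /= e0 eB]].
  by have [y [Ay]] := clA _ (nbhsx_ballx x _ e0); rewrite -ball_normE; exists y.
have [y Ay xy] := H e e0; exists y; split=> //; apply: eB.
by rewrite -ball_normE.
Qed.

Lemma interiorP A x :
  interior A x <-> exists2 e, 0 < e & forall y, `|x - y| < e -> A y.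
Proof.
split=> [/nbhs_ballP[e /= e0 eA]|[e e0 eA]].
  by exists e => // y xy; apply: eA; rewrite -ball_normE.
by apply/nbhs_ballP; exists e => // y; rewrite -ball_normE; exact: eA.
Qed.

Lemma compact_closureE A : compact A -> closure A = A.
Proof. by move=> /(compact_closed (@norm_hausdorff _ _)) /closure_id <-. Qed.

Lemma compact_normP A : compact A -> exists2 M, 0 < M & forall x, A x -> `|x| <= M.
Proof.
move=> /compact_bounded[M [_ HM]]; exists (`|M| + 1); first exact: ltr_wpDl.
by move=> x Ax; apply: HM => //; rewrite (le_lt_trans (ler_norm _))// ltrDl.
Qed.

Lemma compact_boundary A : compact A -> compact (closure A `\` interior A).
Proof.
move=> cA; apply: (subclosed_compact _ cA); last first.
  by move=> x []; rewrite compact_closureE.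
rewrite setDE; apply: closedI; first exact: closed_closure.
by apply: open_closedC; exact: open_interior.
Qed.

(** The boundary point is the last point of the ray in [A]; compactness bounds the parameters
    [T]. *)
Lemma ray_meets_boundary A x u : compact A -> A x -> u != 0 ->
  exists2 t, 0 <= t & (closure A `\` interior A) (x + t *: u).
Proof.
move=> cA Ax u0; have u0' : 0 < `|u| by rewrite normr_gt0.
have [M M0 AM] := compact_normP cA.
pose T := [set t : R | 0 <= t /\ A (x + t *: u)].
have T0 : T 0 by split=> //; rewrite scale0r addr0.
have ubT : has_sup T.
  split; first by exists 0.
  exists ((M + M) / `|u|) => t [t0 At]; rewrite ler_pdivlMr//.
  rewrite -(ger0_norm t0) -normrZ; have -> : t *: u = (x + t *: u) - x.
    by rewrite addrAC subrr add0r.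
  by rewrite (le_trans (ler_normB _ _))// lerD// AM.
have s0 : 0 <= sup T by exact: sup_upper_bound.
exists (sup T) => //.
split.
  apply/closureP => e e0; have [t [t0 At] st] := sup_adherent (divr_gt0 e0 u0') ubT.
  exists (x + t *: u) => //; rewrite opprD addrACA subrr add0r -scalerBl normrZ.
  have tT : t <= sup T by apply: (sup_upper_bound ubT); split.
  rewrite ger0_norm ?subr_ge0//.
  by rewrite -ltr_pdivlMr// ltrBlDr -ltrBlDl.
move=> /interiorP[e e0 eA].
(* From an interior point the ray could go on inside [A] for a distance [e / 2], past the
   supremum. *)
have r0 : 0 < e / 2 / `|u| by rewrite !divr_gt0.
have : T (sup T + e / 2 / `|u|).
  split; first by rewrite addr_ge0// ltW.
  apply: eA; rewrite opprD addrACA subrr add0r -scalerBl opprD addrA subrr sub0r.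
  by rewrite normrZ normrN (gtr0_norm r0) divfK ?gt_eqF//; lra.
move=> /(sup_upper_bound ubT); rewrite gerDl leNgt => /negP; exact.
Qed.

Lemma convex_setP A : convex_set A <->
  forall x y t, A x -> A y -> 0 <= t <= 1 -> A ((1 - t) *: x + t *: y).
Proof.
split=> [cA x y t Ax Ay /andP[t0 t1]|H x y l /set_mem Ax /set_mem Ay].
  have /set_mem := cA y x (Itv01 t0 t1) (mem_set Ay) (mem_set Ax).
  by rewrite /conv/= addrC.
apply/mem_set; rewrite /conv/= addrC; apply: H => //.
by rewrite ge0 le1.
Qed.

End topology_in_norm.

Lemma lipschitz_continuous (R : realType) (V W : normedModType R) (f : V -> W)
    (C : R) : (forall x y, `|f x - f y| <= C * `|x - y|) -> continuous f.
Proof.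
move=> fC x; apply/cvgrPdist_lt => e e0; apply/nbhs_ballP.
have C0 : 0 < `|C| + 1 by apply: ltr_wpDl.
exists (e / (`|C| + 1)); first by rewrite /= divr_gt0.
move=> y; rewrite -ball_normE/= ltr_pdivlMr// => xy.
apply: le_lt_trans (fC _ _) (le_lt_trans _ xy); rewrite mulrC ler_wpM2l//.
by rewrite (le_trans (ler_norm C))// lerDl.
Qed.

(** * Nearest point projection onto a compact convex set *)

Section projection.
Context {R : realType} {n : nat}.
Implicit Types (x y z p : 'rV[R]_n) (K : set 'rV[R]_n).

Lemma edistE x y : edist x y = Num.sqrt (dot (x - y) (x - y)).
Proof. exact: enormE. Qed.

Lemma continuous_dist2 x : continuous (fun z => dot (x - z) (x - z)).
Proof.
refine (@continuous_big R 'I_n +%R 0 xpredT (@add_continuous R) _ _ _ _) => i _.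
have ci : continuous (fun z => (x - z) ord0 i).
  move=> z; under eq_fun do rewrite !mxE.
  exact: (cvgB (@cvg_cst _ (x ord0 i) _ (nbhs z) _) (@coord_continuous _ _ _ ord0 i z)).
by move=> z; exact: (cvgM (ci z) (ci z)).
Qed.

(** The variational inequality that characterizes the point of a convex set nearest to [x]. *)
Definition is_proj K x p := K p /\ forall z, K z -> dot (x - p) (z - p) <= 0.

(** Testing each variational inequality with the other projection and adding gives
    [|p - q|^2 <= <x - y, p - q>]; then [|(x - y) - (p - q)|^2 >= 0] finishes. *)
Lemma is_proj_lipschitz K x y p q : is_proj K x p -> is_proj K y q ->
  edist p q <= edist x y.
Proof.
move=> [Kp xp] [Kq yq]; rewrite !edistE ler_sqrt ?dotxx_ge0//.
have := xp _ Kq; have := yq _ Kp.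
have := dotxx_ge0 ((x - y) - (p - q)).
rewrite !dotE !(dotC y x) !(dotC p x) !(dotC q x) !(dotC p y) !(dotC q y) !(dotC q p).
lra.
Qed.

Lemma is_proj_unique K x p q : is_proj K x p -> is_proj K x q -> p = q.
Proof.
move=> Hp Hq; have := is_proj_lipschitz Hp Hq.
have -> : edist x x = 0.
  by rewrite edistE subrr /dot big1 ?sqrtr0// => i _; rewrite mxE mul0r.
move=> pq; apply/eqP; rewrite -subr_eq0 -normr_le0.
exact: le_trans (norm_le_enorm _) pq.
Qed.

(** A minimizer [p] of the squared distance works: were the inner product positive at some [z], a
    move from [p] towards [z] would come closer to [x]. *)
Lemma projection_exists K : compact K -> convex_set K -> K !=set0 ->
  exists pr : 'rV[R]_n -> 'rV[R]_n, forall x, is_proj K x (pr x).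
Proof.
move=> cK /convex_setP xK K0.
suff H x : exists p, is_proj K x p.
  by exists (fun x => sval (cid (H x))) => x; case: cid.
have [p /set_mem Kp pmin] :=
  EVT_min_rV K0 cK (continuous_subspaceT (@continuous_dist2 x)).
exists p; split=> // z Kz; rewrite leNgt; apply/negP => a0.
set a := dot _ _ in a0; pose b := dot (z - p) (z - p).
have b0 : 0 <= b by exact: dotxx_ge0.
have ab0 : 0 < a + b by rewrite ltr_wpDr.
(* Moving by [t] changes the squared distance by [t * (t * b - 2 * a)]; this [t] is in [0, 1] and
   has [t * b < a]. *)
pose t := a / (a + b).
have t01 : 0 <= t <= 1.
  by rewrite /t divr_ge0 ?(ltW a0) ?(ltW ab0)//= ler_pdivrMr// mul1r lerDl.
have t0 : 0 < t by rewrite divr_gt0.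
have := pmin _ (mem_set (xK _ _ _ Kp Kz t01)).
have -> : x - ((1 - t) *: p + t *: z) = (x - p) - t *: (z - p).
  by apply/rowP => i; rewrite !mxE; ring.
rewrite leNgt => /negP; apply.
rewrite [ltLHS]dotDl [in ltLHS]dotDr [X in _ + X]dotDr !(dotNl, dotNr, dotZl, dotZr).
rewrite (dotC (z - p) (x - p)) -/a -/b.
have tb : t * b < a.
  rewrite /t mulrAC ltr_pdivrMr//; nra.
nra.
Qed.

End projection.

(* Every point [y] of the boundary of [K] is a limit of projections [pr w] of
   points [w] outside [K], and the ray from [pr w] through [w] projects to [pr w]
   and leaves [L] at a boundary point. *)
Lemma perimeter_affine (R : realType) n (K L : set 'rV[R]_n) (c : R) v :
  compact K -> convex_set K -> K !=set0 -> compact L -> 0 < c ->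
  (forall z, K z -> L (c *: z + v)) ->
  (perimeter K <= (c^-1 ^+ n.-1)%:E * perimeter L)%E.
Proof.
move=> cK xK K0 cL c0 KL; have [pr prP] := projection_exists cK xK K0.
(* Undo the similarity, then project: [f] is [c^-1]-Lipschitz, and the image of the boundary of [L]
   is shown to contain that of [K]. *)
pose f (x : 'rV[R]_n) := pr (c^-1 *: (x - v)).
have fL x y : edist (f x) (f y) <= c^-1 * edist x y.
  apply: le_trans (is_proj_lipschitz (prP _) (prP _)) _.
  rewrite /edist -scalerBr enormZ ?invr_ge0 ?(ltW c0)//.
  by rewrite opprB addrA subrK.
apply: (@hausdorff_lipschitz _ _ _ _ f) => //; first by rewrite invr_gt0.
have prK y : K y -> pr y = y.
  move=> Ky; apply: is_proj_unique (prP y) _; split=> // z _.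
  by rewrite subrr /dot big1// => i _; rewrite mxE mul0r.
have cf : continuous f.
  apply: (@lipschitz_continuous _ _ _ _ (c^-1 * n%:R)) => x y.
  apply: le_trans (norm_le_enorm _) _; apply: le_trans (fL x y) _.
  by rewrite -mulrA ler_pM2l ?invr_gt0// enorm_le_norm.
have cfL : compact (f @` (closure L `\` interior L)).
  by apply: continuous_compact; [exact: continuous_subspaceT|exact: compact_boundary].
(* The image is compact, hence closed, so it suffices to approximate [y] by its points. *)
rewrite -(compact_closureE cfL) => y [+ yI]; rewrite (compact_closureE cK) => Ky.
apply/closureP => e e0; have n1 : 0 < n%:R + 1 :> R by rewrite ltr_wpDl.
(* The divisor absorbs the factor [n] between the Euclidean and the sup norm. *)
have [w [nKw yw]] : exists w, ~ K w /\ `|y - w| < e / (n%:R + 1).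
  apply: contrapT => H; apply: yI; apply/interiorP.
  exists (e / (n%:R + 1)); first exact: divr_gt0.
  by move=> w yw; apply: contrapT => nKw; apply: H; exists w.
have [Kp wp] := prP w.
have wp0 : w - pr w != 0.
  by apply: contra_notN nKw => /eqP/subr0_eq ->.
have [t t0 bd] := ray_meets_boundary cL (KL _ Kp) wp0.
exists (pr w).
  exists (c *: pr w + v + t *: (w - pr w)) => //.
  apply: is_proj_unique (prP _) _; split=> // z Kz.
  rewrite addrAC addrK scalerDr !scalerA mulVf ?gt_eqF// scale1r addrAC subrr add0r.
  by rewrite dotZl mulr_ge0_le0 ?mulr_ge0 ?invr_ge0 ?(ltW c0)//; exact: wp.
apply: le_lt_trans (norm_le_enorm _) _; rewrite -{1}(prK y Ky).
apply: le_lt_trans (is_proj_lipschitz (prP y) (prP w)) _.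
apply: le_lt_trans (enorm_le_norm _) _.
move: yw; rewrite ltr_pdivlMr// mulrC; apply: le_lt_trans.
by rewrite ler_wpM2r// lerDl.
Qed.

(** * Inradius and diameter from a perimeter bound *)

(** The ball lies between the centered cubes of half-side [1 / k] and 1. *)
Lemma unit_ball_volume_fin (R : realType) k :
  exists2 w : R, 0 < w & unit_ball_volume R k = w%:E.
Proof.
have lb : ((\prod_(i < k) (2 / k%:R))%:E <= unit_ball_volume R k)%E.
  have -> : \prod_(i < k) (2 / k%:R) = \prod_(i < k)
      ((\row_j (k%:R^-1 : R)) ord0 i - (\row_j (- k%:R^-1 : R)) ord0 i).
    by apply: eq_bigr => i _; rewrite !mxE; ring.
  apply: box_le_volume => [i|x xb].
    by rewrite !mxE (@le_trans _ _ 0)// oppr_le0.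
  rewrite /=; apply: le_trans (enorm_le_norm x) _.
  apply: (@le_trans _ _ (k%:R * k%:R^-1)).
    rewrite ler_wpM2l//; apply/norm_leP => // i.
    by have := xb i; rewrite !mxE -ler_norml.
  by case: (k) => [|k']; rewrite ?mul0r// divff// pnatr_eq0.
have ub : (unit_ball_volume R k <= (2 ^+ k)%:E)%E.
  have -> : 2 ^+ k = \prod_(i < k)
      ((\row_j (1 : R)) ord0 i - (\row_j (- 1 : R)) ord0 i).
    rewrite -[X in _ ^+ X]card_ord -prodr_const.
    by apply: eq_bigr => i _; rewrite !mxE; ring.
  apply: volume_le_box => [i|x /= x1 i]; first by rewrite !mxE; lra.
  rewrite !mxE -ler_norml.
  exact: le_trans (entry_le_norm _ _) (le_trans (norm_le_enorm _) x1).
have fin : unit_ball_volume R k \is a fin_num.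
  by rewrite ge0_fin_numE ?volume_ge0// (le_lt_trans ub)// ltry.
exists (fine (unit_ball_volume R k)); last by rewrite fineK.
rewrite -lte_fin fineK//; apply: lt_le_trans lb.
rewrite lte_fin prodr_gt0// => i _.
by rewrite divr_gt0// ltr0n (leq_ltn_trans _ (ltn_ord i)).
Qed.

Section inscribed_cube.
Context {R : realType}.

(* A point of [E] can be moved in direction [e_i] onto the boundary by at most
   [w], so a cover of the boundary by small sets [U_j] yields a cover of [E] by
   boxes elongated by [w] in direction [e_i]. *)
Lemma volume_le_perimeter n : exists2 C : R, 0 < C &
  forall (E : set 'rV[R]_n.+1) (i : 'I_n.+1) w, compact E -> 0 < w ->
    (forall x t, E x -> 0 <= t -> E (x + t *: delta_mx ord0 i) -> t <= w) ->
    (volume E <= (C * w)%:E * perimeter E)%E.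
Proof.
have [om om0 omE] := unit_ball_volume_fin R n.
(* Times [w], this is the ratio of the box volume [4 w (2 d)^n] to the premeasure term
   [om (d / 2)^n]. *)
exists (4 * 4 ^+ n / om); first by rewrite divr_gt0// mulr_gt0// exprn_gt0.
move=> E i w cE w0 chord; set C := _ / om.
have C0 : 0 < C by rewrite divr_gt0// mulr_gt0// exprn_gt0.
have Cw : 0 < C * w by rewrite mulr_gt0.
apply: (@le_trans _ _ ((C * w)%:E *
    hausdorff_premeasure n w (closure E `\` interior E))%E); last first.
  by rewrite lee_pmul2l//; apply: ereal_sup_ubound; exists w.
rewrite muleC -lee_pdivrMr//; apply: le_ereal_inf_tmp => _ [D [U [Uw EU ->]]].
rewrite lee_pdivrMr// muleC -esumZl ?(ltW Cw)//; last first.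
  by move=> j _; rewrite mule_ge0 ?volume_ge0// expe_ge0// mule_ge0 ?diam_ge0.
have dP j : {d | 0 <= d & diam (U j) = d%:E} by apply/cid2/(diam_fin (Uw j)).
pose d j := s2val (dP j).
have d0 j : 0 <= d j by exact: s2valP (dP j).
have dE j : diam (U j) = (d j)%:E by exact: s2valP' (dP j).
have dw j : d j <= w by rewrite -lee_fin -dE.
pose u j := xget 0 (U j).
(* In direction [i] the half-side [2 * w] pays for the slide, at most [w], and for [d j <= w]. *)
pose s j : 'rV[R]_n.+1 := \row_k (if k == i then 2 * w else d j).
have s0 j k : 0 <= s j ord0 k.
  by rewrite mxE; case: ifP => _ //; rewrite mulr_ge0 ?(ltW w0).
apply: ereal_inf_lbound; exists D, (fun j => u j - s j), (fun j => u j + s j); split.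
- by move=> j k; move: (s0 j k); rewrite !mxE; lra.
- move=> x Ex; have e0 : delta_mx ord0 i != 0 :> 'rV[R]_n.+1.
    apply/eqP => /rowP/(_ i); rewrite !mxE !eqxx/= => /eqP.
    by rewrite oner_eq0.
  have [t t0 bd] := ray_meets_boundary cE Ex e0.
  have tw : t <= w by apply: chord Ex t0 _; case: bd; rewrite compact_closureE.
  have [j Dj Uj] := EU _ bd; exists j => // k.
  have Uu : U j (u j) by apply: xgetPex; exists (x + t *: delta_mx ord0 i).
  have : `|(x + t *: delta_mx ord0 i - u j) ord0 k| <= d j.
    apply: le_trans (entry_le_norm _ _) (le_trans (norm_le_enorm _) _).
    by rewrite -lee_fin -dE; exact: edist_le_diam.
  have := dw j.
  rewrite ler_norml !mxE eqxx /=; case: (k == i) => /=; rewrite ?mulr1 ?mulr0; lra.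
- apply: eq_esum => j _.
  have -> : \prod_(k < n.+1) ((u j + s j) ord0 k - (u j - s j) ord0 k) =
      4 * w * (2 * d j) ^+ n.
    rewrite (bigD1 i)//= (eq_bigr (fun=> 2 * d j)); last first.
      by move=> k /negbTE ki; rewrite !mxE ki; ring.
    rewrite prodr_const cardC1 card_ord/=; congr (_ * _).
    by rewrite !mxE eqxx; ring.
  rewrite -/(unit_ball_volume R n) omE dE -!EFinM -!EFin_expe -!EFinM; congr EFin.
  rewrite /C !exprMn exprVn (_ : 4 ^+ n = 2 ^+ n * 2 ^+ n); last first.
    by rewrite -exprMn; congr (_ ^+ _); ring.
  have p2 : (2 : R) ^+ n != 0 by rewrite expf_neq0.
  by field; rewrite p2 gt_eqF.
Qed.

Lemma convex_average (V : normedModType R) (E : set V) m (f : 'I_m.+1 -> V) :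
  convex_set E -> (forall i, E (f i)) -> E (m.+1%:R^-1 *: \sum_(i < m.+1) f i).
Proof.
move=> /convex_setP xE; elim: m f => [|m IH] f Ef.
  by rewrite invr1 scale1r big_ord1.
rewrite big_ord_recr/=.
have m1 : 0 < m.+1%:R :> R by rewrite ltr0n.
have m2 : 0 < m.+2%:R :> R by rewrite ltr0n.
have := xE _ _ m.+2%:R^-1 (IH (fun i => f (widen_ord (leqnSn _) i)) _) (Ef ord_max).
rewrite scalerA (_ : (1 - m.+2%:R^-1) * m.+1%:R^-1 = m.+2%:R^-1); last first.
  rewrite -(natr1 m.+1); move: m1; move: (m.+1%:R : R) => a a0.
  by field; rewrite (gt_eqF a0) gt_eqF// addr_gt0.
rewrite -scalerDr; apply=> //.
by rewrite invr_ge0 ltW//= invf_le1// ler1n.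
Qed.

(* [E] has a chord longer than [w = 1 / (2 C p)] in every coordinate direction,
   and the average of these chords is a cube of side [w / (n + 1)]. *)
Lemma inscribed_cube n : exists2 c : R, 0 < c <= 1 &
  forall (E : set 'rV[R]_n.+1) p, compact E -> convex_set E -> volume E = 1%E ->
    1 <= p -> (perimeter E <= p%:E)%E ->
    exists x0, forall z, `|z| <= c / p -> E (x0 + z).
Proof.
have [C C0 HC] := volume_le_perimeter n.
(* The second entry gives [n.+1 * (c / p) <= w / 2] for the [w] below. *)
pose c := Num.min 1 (4 * C * n.+1%:R)^-1.
have cC : 0 < (4 * C * n.+1%:R)^-1 by rewrite invr_gt0 !mulr_gt0.
exists c; first by rewrite lt_min ltr01 cC/= ge_min lexx.
move=> E p cE xE vE p1 Pp; have p0 : 0 < p by exact: lt_le_trans p1.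
(* Now [C * w * p = 1 / 2 < 1], so in no direction can all chords have length at most [w]. *)
pose w := (2 * C * p)^-1; have w0 : 0 < w by rewrite invr_gt0 !mulr_gt0.
have chord i : exists x, forall s, 0 <= s <= w -> E (x + s *: delta_mx ord0 i).
  have [[x [t [Ex t0 Et wt]]]|H] := pselect (exists x t,
      [/\ E x, 0 <= t, E (x + t *: delta_mx ord0 i) & w < t]).
    have t0' : 0 < t by exact: lt_trans wt.
    exists x => s /andP[s0 sw]; have /convex_setP := xE.
    move=> /(_ _ _ (s / t) Ex Et); rewrite scalerDr scalerA divfK ?gt_eqF// addrA.
    rewrite -scalerDl subrK scale1r; apply.
    by rewrite divr_ge0//= ler_pdivrMr// mul1r (le_trans sw)// ltW.
  exfalso; have := HC E i w cE w0 _; rewrite vE => H'.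
  have : (1%:E <= (C * w)%:E * p%:E :> \bar R)%E.
    apply: (le_trans (H' _)); last by rewrite lee_pmul2l// lte_fin mulr_gt0.
    move=> x t Ex t0 Et; rewrite leNgt; apply/negP => wt; apply: H.
    by exists x, t.
  rewrite -EFinM lee_fin /w; have -> : C * (2 * C * p)^-1 * p = 2^-1.
    by field; rewrite !gt_eqF.
  lra.
have xP i := cid (chord i); pose x i := sval (xP i).
have Ex i s : 0 <= s <= w -> E (x i + s *: delta_mx ord0 i) by exact: (svalP (xP i)).
have n0 : 0 < n.+1%:R :> R by rewrite ltr0n.
exists (n.+1%:R^-1 *: \sum_(i < n.+1) (x i + (w / 2) *: delta_mx ord0 i)) => z zc.
have zw i : `|n.+1%:R * z ord0 i| <= w / 2.
  rewrite normrM ger0_norm// mulrC -ler_pdivlMr//.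
  apply: le_trans (entry_le_norm _ _) (le_trans zc _).
  apply: (@le_trans _ _ ((4 * C * n.+1%:R)^-1 / p)).
    by rewrite ler_pM2r ?invr_gt0// ge_min lexx orbT.
  rewrite /w le_eqVlt; apply/orP; left; apply/eqP.
  by field; rewrite !gt_eqF// n0 p0.
(* The shift is shared among the chords: [n.+1 * z_i] moves the midpoint of chord [i] by at most
   [w / 2], so it stays on the chord. *)
have -> : n.+1%:R^-1 *: (\sum_(i < n.+1) (x i + w / 2 *: delta_mx ord0 i)) + z =
    n.+1%:R^-1 *: (\sum_(i < n.+1)
      (x i + (w / 2 + n.+1%:R * z ord0 i) *: delta_mx ord0 i)).
  rewrite [in LHS](row_sum_delta z) -[X in _ + X](scalerK (lt0r_neq0 n0)).
  rewrite -scalerDr scaler_sumr -big_split/=; congr (_ *: _).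
  by apply: eq_bigr => i _; rewrite scalerA -addrA -scalerDl.
apply: convex_average => // i; apply: Ex.
by move: (zw i); rewrite ler_norml => /andP[]; lra.
Qed.

(* By convexity, [E] contains cubes of half the size centered on the first half
   of the segment from [x0] to [q]; their volumes add up to at most 1. *)
Lemma le_norm_of_inscribed_cube n (E : set 'rV[R]_n.+1) h x0 :
  convex_set E -> volume E = 1%E -> 0 < h <= 1 ->
  (forall z, `|z| <= h -> E (x0 + z)) ->
  forall q, E q -> `|q - x0| <= 4 * h ^- n.+1.
Proof.
move=> /convex_setP xE vE /andP[h0 h1] cube q Eq.
have hn : 0 < h ^+ n.+1 by rewrite exprn_gt0.
have hn1 : 1 <= h ^- n.+1 by rewrite invf_ge1// exprn_ile1// ltW.
(* More than [h ^- n.+1] cubes of volume [h ^+ n.+1] have total volume above 1. *)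
pose M := (Num.truncn (h ^- n.+1)).+1.
have M0 : 0 < M%:R :> R by rewrite ltr0n.
have MgtE : h ^- n.+1 < M%:R by exact: truncnS_gt.
have Mle : M%:R <= h ^- n.+1 + 1.
  by rewrite /M -natr1 lerD2r truncn_le// ltW// invr_gt0.
suff H : `|q - x0| <= 2 * h * M%:R.
  apply: (le_trans H); apply: (@le_trans _ _ (2 * 1 * (h ^- n.+1 + 1))); last lra.
  by apply: ler_pM => //; rewrite ?mulr_ge0 ?ler_pM2l// ltW.
apply/norm_leP => [|i]; first by rewrite !mulr_ge0 ?(ltW h0).
rewrite leNgt; apply/negP => Hi.
(* By [Hi], consecutive centers differ by more than [h] in coordinate [i], so cubes of side [h]
   around them are disjoint. *)
pose tau (m : 'I_M) : R := m%:R / (2 * M%:R).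
have tau01 m : 0 <= tau m <= 2^-1.
  rewrite /tau divr_ge0 ?mulr_ge0//= ler_pdivrMr ?mulr_gt0// mulKf//.
  by rewrite ler_nat ltnW.
pose ctr m := x0 + tau m *: (q - x0).
pose hh : 'rV[R]_n.+1 := const_mx (h / 2).
have boxP m x : box (ctr m - hh) (ctr m + hh) x -> `|x - ctr m| <= h / 2.
  move=> xb; apply/norm_leP => [|k]; first by rewrite divr_ge0// ltW.
  by have := xb k; rewrite !mxE ler_norml; lra.
have ineq := @packing_le_volume _ n.+1 M (fun m => ctr m - hh) (fun m => ctr m + hh) E.
have : (\sum_(m < M) (h ^+ n.+1)%:E <= 1 :> \bar R)%E.
  rewrite -vE; apply: le_trans (ineq _ _ _).
  - rewrite le_eqVlt; apply/orP; left; apply/eqP; apply: eq_bigr => m _; congr EFin.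
    rewrite -[X in _ ^+ X](card_ord n.+1) -prodr_const.
    by apply: eq_bigr => k _; rewrite !mxE; field.
  - by move=> m k; rewrite !mxE; lra.
  - move=> m x /boxP xm; have /andP[t0 t2] := tau01 m.
    have t1 : 0 < 1 - tau m by lra.
    (* Since [1 - tau m >= 1 / 2], the point paired with [q] lies in the given cube around [x0]. *)
    have -> : x = (1 - tau m) *: (x0 + (1 - tau m)^-1 *: (x - ctr m)) + tau m *: q.
      rewrite scalerDr scalerA divff ?gt_eqF// scale1r /ctr.
      by apply/rowP => k; rewrite !mxE; ring.
    apply: xE => //; last by rewrite t0/=; lra.
    apply: cube; rewrite normrZ ger0_norm ?invr_ge0 ?(ltW t1)//.
    rewrite mulrC ler_pdivrMr// (le_trans xm)// ler_pM2l//; lra.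
  - move=> m m' x /boxP xm /boxP xm'; apply/eqP; rewrite -[_ == _]negbK.
    apply/negP => mm'.
    have d1 : 1 <= `|m%:R - m'%:R : R|.
      case: (ltngtP m m') => [lt|lt|/val_inj eq]; last by rewrite eq eqxx in mm'.
        rewrite distrC; apply: le_trans (ler_norm _).
        by rewrite lerBrDr addrC natr1 ler_nat.
      apply: le_trans (ler_norm _).
      by rewrite lerBrDr addrC natr1 ler_nat.
    have : `|(ctr m - ctr m') ord0 i| <= h.
      apply: le_trans (entry_le_norm _ _) _.
      rewrite -(subrKA x) (le_trans (ler_normD _ _))// -normrN opprB.
      lra.
    rewrite (_ : (ctr m - ctr m') ord0 i =
        (m%:R - m'%:R) * ((q - x0) ord0 i / (2 * M%:R))); last first.
      by rewrite /ctr /tau !mxE; field; rewrite gt_eqF.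
    rewrite normrM => H; have : `|(q - x0) ord0 i / (2 * M%:R)| <= h.
      by apply: le_trans H; rewrite ler_peMl.
    rewrite normrM [X in _ * X]ger0_norm; last by rewrite invr_ge0 mulr_ge0.
    rewrite ler_pdivrMr ?mulr_gt0// leNgt => /negP; apply.
    by rewrite mulrA (mulrC h).
rewrite sumEFin lee_fin sumr_const card_ord -mulr_natl -ler_pdivlMr// mul1r.
by rewrite leNgt MgtE.
Qed.

End inscribed_cube.

(** * Riesz energy *)

(* No integrability is assumed: both sides may be [+oo]. *)
Lemma integral_shift d (T : measurableType d) (R : realType)
    (P : {measure set T -> \bar R}) (D : set T) (f : T -> \bar R) (b : R) :
  measurable D -> P D = 1%E -> measurable_fun D f -> 0 <= b ->
  (forall x, D x -> (- b%:E <= f x)%E) ->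
  (\int[P]_(x in D) (f x + b%:E) = \int[P]_(x in D) f x + b%:E)%E.
Proof.
move=> mD PD mf b0 fb; have b0' : (0 <= b%:E)%E by rewrite lee_fin.
have fn_le x : D x -> (f^\- x <= b%:E)%E.
  by move=> Dx; rewrite funenegE ge_max b0' andbT leeNl fb.
have intb : (\int[P]_(x in D) b%:E = b%:E)%E.
  by rewrite (integral_cst P mD b%:E) [X in (_ * X)%E]PD mule1.
have In : (\int[P]_(x in D) f^\- x)%E \is a fin_num.
  rewrite ge0_fin_numE ?integral_ge0//; apply: le_lt_trans (ltry b).
  rewrite -[leRHS]intb; apply: ge0_le_integral => //.
  exact: measurable_funeneg.
have mfn : measurable_fun D (f^\-)%E by exact: measurable_funeneg.
have mfp : measurable_fun D (f^\+)%E by exact: measurable_funepos.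
(* Adding [f^-] to [f + b] gives [f^+ + b]; every summand split off is nonnegative, and the finite
   integral of [f^-] is subtracted at the end. *)
have E1 : (\int[P]_(x in D) ((f x + b%:E) + f^\- x) =
    \int[P]_(x in D) (f x + b%:E) + \int[P]_(x in D) f^\- x)%E.
  rewrite ge0_integralD//; last by apply: emeasurable_funD.
  by move=> x Dx; rewrite -leeBlDr// sub0e fb.
have E2 : (\int[P]_(x in D) (f^\+ x + b%:E) = \int[P]_(x in D) f^\+ x + b%:E)%E.
  by rewrite -[in RHS]intb ge0_integralD.
have : (\int[P]_(x in D) ((f x + b%:E) + f^\- x) =
        \int[P]_(x in D) (f^\+ x + b%:E))%E.
  apply: eq_integral => x /set_mem Dx; have := fn_le _ Dx; have := fb _ Dx.
  rewrite funeposE funenegE; case: (f x) => [r| |] //.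
    rewrite -!EFinN !lee_fin -!EFin_max -!EFinD => _ _; congr EFin.
    by rewrite /Num.max; case: ifPn => h1; case: ifPn => h2; lra.
  by move=> _ _; rewrite maxye /= maxNye adde0.
rewrite E1 E2 => /(congr1 (fun z => z - \int[P]_(x in D) f^\- x)%E).
rewrite addeK// => ->; rewrite [in RHS]integralE.
by rewrite addeAC.
Qed.

Section energy.
Context {R : realType} {n : nat}.
Implicit Types (E F : set 'rV[R]_n) (x y : 'rV[R]_n) (mu : probability (borel R n) R).

Lemma measurable_closed_borel E : closed E -> measurable (E : set (borel R n)).
Proof.
move=> cE; rewrite -(setCK E); apply: measurableC; apply: sub_sigma_algebra.
exact: closed_openC.
Qed.

Lemma continuous_measurable_borel (f : 'rV[R]_n -> R) : continuous f ->
  measurable_fun [set: borel R n] (f : borel R n -> R).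
Proof.
move=> /continuousP cf; apply: (measurability _ (RGenOpens.measurableE R)).
move=> _ [_ [a [b ->] <-]]; rewrite setTI; apply: sub_sigma_algebra.
exact/cf/interval_open.
Qed.

Lemma continuous_measurable_borel_map (f : 'rV[R]_n -> 'rV[R]_n) : continuous f ->
  measurable_fun [set: borel R n] (f : borel R n -> borel R n).
Proof.
move=> /continuousP cf.
apply: (@measurability _ _ (borel R n) (borel R n) setT f (@open _)) => //.
move=> _ [A oA <-]; rewrite setTI; apply: sub_sigma_algebra.
exact: cf.
Qed.

(** The sigma-algebra is the product of the two Borel ones, so the distance is assembled from
    coordinates of each factor. *)
Lemma measurable_edist :
  measurable_fun [set: borel R n * borel R n] (fun p => edist p.1 p.2).
Proof.
apply: (measurableT_comp (continuous_measurable_fun (@sqrt_continuous R))).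
apply: measurable_sum => i.
apply: measurable_funX; under eq_fun do rewrite !mxE.
have mi : measurable_fun [set: borel R n] (fun x : borel R n => (x : 'rV[R]_n) ord0 i).
  by apply: (@continuous_measurable_borel (fun x => x ord0 i)); exact: coord_continuous.
exact: (measurable_funB (measurableT_comp mi measurable_fst)
  (measurableT_comp mi measurable_snd)).
Qed.

Lemma edist_eq0 x y : (edist x y == 0) = (x == y).
Proof.
apply/eqP/eqP => [xy|->]; last first.
  by rewrite edistE subrr /dot big1 ?sqrtr0// => i _; rewrite mxE mul0r.
apply/eqP; rewrite -subr_eq0 -normr_le0 -xy.
exact: norm_le_enorm.
Qed.

Definition riesz_profile (alpha d : R) : \bar R :=
  if d == 0 then +oo%E else if alpha == 0 then (- ln d)%:E else (d `^ (- alpha))%:E.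

Lemma riesz_kernelE alpha x y :
  riesz_kernel alpha x y = riesz_profile alpha (edist x y).
Proof.
rewrite /riesz_kernel /riesz_profile edist_eq0; case: ifPn => // xy.
have d0 : 0 < edist x y by rewrite lt_def edist_eq0 xy edist_ge0.
case: ifPn => _; first by rewrite div1r lnV.
by rewrite powRN div1r.
Qed.

Lemma measurable_riesz_kernel alpha : measurable_fun [set: borel R n * borel R n]
  (fun p => riesz_kernel alpha p.1 p.2).
Proof.
under eq_fun do rewrite riesz_kernelE.
apply: (measurableT_comp _ measurable_edist).
apply: measurable_fun_ifT => //; first exact: measurable_fun_eqr.
case: (alpha == 0); last by apply/measurable_EFinP; exact: measurable_powR.
by apply/measurable_EFinP; apply: measurableT_comp => //; exact: measurable_ln.
Qed.

Definition log_shift (alpha c : R) : R := if alpha == 0 then ln c else 0.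

(* The logarithmic kernel is homogeneous only up to the additive constant
   [ln c]. *)
Lemma riesz_kernel_affine alpha c v x y : 0 < c ->
  riesz_kernel alpha (c^-1 *: (x - v)) (c^-1 *: (y - v)) =
  ((c `^ alpha)%:E * riesz_kernel alpha x y + (log_shift alpha c)%:E)%E.
Proof.
move=> c0; rewrite !riesz_kernelE /riesz_profile.
have -> : edist (c^-1 *: (x - v)) (c^-1 *: (y - v)) = c^-1 * edist x y.
  by rewrite /edist -scalerBr enormZ ?invr_ge0 ?(ltW c0)// opprB addrA subrK.
have c0' : c^-1 != 0 by rewrite invr_eq0 gt_eqF.
rewrite mulf_eq0 (negbTE c0')/= /log_shift; case: ifPn => [_|d0].
  by rewrite gt0_muley ?addye// lte_fin powR_gt0.
have d0' : 0 < edist x y by rewrite lt_def d0 edist_ge0.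
case: ifPn => [/eqP->|_].
  rewrite powRr0 mul1e lnM ?posrE ?invr_gt0// lnV ?posrE//.
  by rewrite -EFinD; congr EFin; ring.
rewrite adde0 powRM ?invr_ge0 ?(ltW c0) ?(ltW d0')// EFinM; congr (_%:E * _)%E.
by rewrite -powR_inv1 ?(ltW c0)// -powRrM mulN1r opprK.
Qed.

(** For [D0 >= 1] the bound is nonpositive, so it also covers the power kernels, which are
    nonnegative. *)
Lemma riesz_kernel_ge alpha x y D0 : 0 <= alpha -> 1 <= D0 -> edist x y <= D0 ->
  (- (ln D0)%:E <= riesz_kernel alpha x y)%E.
Proof.
move=> a0 D1 xyD; rewrite riesz_kernelE /riesz_profile; case: ifPn => [_|d0].
  exact: leey.
have d0' : 0 < edist x y by rewrite lt_def d0 edist_ge0.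
have D0' : 0 < D0 by exact: lt_le_trans D1.
case: ifPn => _; rewrite -EFinN lee_fin.
  by rewrite lerN2 ler_ln.
by rewrite (@le_trans _ _ 0) ?powR_ge0// oppr_le0 ln_ge0.
Qed.

Lemma supported_measure1 mu E : compact E -> supported_probability E mu ->
  mu (E : set (borel R n)) = 1%E.
Proof.
move=> cE; rewrite /supported_probability/= (compact_closureE cE) => muE.
have mE := measurable_closed_borel (compact_closed (@norm_hausdorff _ _) cE).
rewrite -(setCK E) probability_setC; last exact: measurableC.
by rewrite muE sube0.
Qed.

Lemma supported_measure2 mu E : compact E -> supported_probability E mu ->
  (mu \x mu)%E ((E : set (borel R n)) `*` (E : set (borel R n))) = 1%E.
Proof.
move=> cE muE.
have mE := measurable_closed_borel (compact_closed (@norm_hausdorff _ _) cE).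
rewrite product_measure1E// [X in (X * _)%E](supported_measure1 cE muE).
by rewrite [X in (_ * X)%E](supported_measure1 cE muE) mule1.
Qed.

Lemma energy_ge alpha E D0 : compact E -> 0 <= alpha -> 1 <= D0 ->
  (forall x y, E x -> E y -> edist x y <= D0) ->
  (- (ln D0)%:E <= energy alpha E)%E.
Proof.
move=> cE a0 D1 ED; apply: le_ereal_inf_tmp => _ [mu muE <-].
have mE := measurable_closed_borel (compact_closed (@norm_hausdorff _ _) cE).
have mEE : measurable ((E : set (borel R n)) `*` (E : set (borel R n))).
  exact: measurableX.
have kD p : (E `*` E) p -> (- (ln D0)%:E <= riesz_kernel alpha p.1 p.2)%E.
  by move=> [Ep1 Ep2]; apply: riesz_kernel_ge => //; exact: ED.
have mk := measurable_funTS (D := (E : set (borel R n)) `*` (E : set (borel R n)))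
  (measurable_riesz_kernel alpha).
have := integral_shift mEE (supported_measure2 cE muE) mk (ln_ge0 D1) kD.
set I := (X in _ = (X + _)%E) => H; rewrite -[leLHS]sub0e leeBlDr// -H.
apply: integral_ge0 => p Ep; rewrite -leeBlDr// sub0e; exact: kD.
Qed.

(** A probability on [F] is pushed forward to [E] by [x -> c^-1 (x - v)], which changes the kernel
    as in [riesz_kernel_affine]. *)
Lemma energy_affine alpha E F c v : compact E -> compact F -> 0 <= alpha -> 1 <= c ->
  (forall x, F x -> E (c^-1 *: (x - v))) ->
  (energy alpha E <= (c `^ alpha)%:E * energy alpha F + (log_shift alpha c)%:E)%E.
Proof.
move=> cE cF a0 c1 FE; have c0 : 0 < c by exact: lt_le_trans c1.
have ca0 : 0 < c `^ alpha by exact: powR_gt0.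
have ls0 : 0 <= log_shift alpha c by rewrite /log_shift; case: ifP => // _; exact: ln_ge0.
rewrite -leeBlDr// muleC -lee_pdivrMr//.
apply: le_ereal_inf_tmp => _ [mu muF <-]; rewrite lee_pdivrMr// muleC leeBlDr//.
pose BE : set (borel R n) := E; pose BF : set (borel R n) := F.
have mE : measurable BE.
  exact: measurable_closed_borel (compact_closed (@norm_hausdorff _ _) cE).
have mF : measurable BF.
  exact: measurable_closed_borel (compact_closed (@norm_hausdorff _ _) cF).
pose psi (x : borel R n) : borel R n := c^-1 *: ((x : 'rV[R]_n) - v).
have mpsi : measurable_fun setT psi.
  apply: (@continuous_measurable_borel_map (fun x => c^-1 *: (x - v))).
  apply: (@lipschitz_continuous _ _ _ _ c^-1) => x y.
  by rewrite -scalerBr normrZ opprB addrA subrK gtr0_norm ?invr_gt0.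
pose psiM : {mfun borel R n >-> borel R n} :=
  HB.pack psi (isMeasurableFun.Build _ _ _ _ _ mpsi).
pose nu : probability (borel R n) R := distribution mu psiM.
have nuE : supported_probability E nu.
  rewrite /supported_probability/= (compact_closureE cE).
  apply/eqP; rewrite eq_le measure_ge0 andbT.
  rewrite /nu/= /distribution/= /pushforward.
  move: muF; rewrite /supported_probability/= (compact_closureE cF) => <-.
  apply: le_measure; rewrite ?inE.
  - by rewrite -[X in measurable X]setTI; apply: (mpsi) => //; exact: measurableC.
  - exact: measurableC.
  - by move=> x /= nEx Fx; exact/nEx/FE.
have [M M0 EM] := compact_normP cE.
(* A diameter bound for [E]: adding [b = ln D0] makes the kernel nonnegative on [E * E], as the
   transport of integrals below requires. *)
pose D0 := 1 + n%:R * (M + M).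
have D1 : 1 <= D0 by rewrite lerDl mulr_ge0// addr_ge0// ltW.
have ED x y : E x -> E y -> edist x y <= D0.
  move=> Ex Ey; apply: le_trans (enorm_le_norm _) _.
  rewrite (@le_trans _ _ (n%:R * (M + M)))//.
    by rewrite ler_wpM2l// (le_trans (ler_normB _ _))// lerD// EM.
  by rewrite lerDr.
pose b := ln D0; have b0 : 0 <= b := ln_ge0 D1.
have mEE : measurable (BE `*` BE) by exact: measurableX.
have mFF : measurable (BF `*` BF) by exact: measurableX.
pose K (p : borel R n * borel R n) : \bar R := riesz_kernel alpha p.1 p.2.
have mK : measurable_fun setT K := measurable_riesz_kernel alpha.
have KD p : (BE `*` BE) p -> (- b%:E <= K p)%E.
  by move=> [Ep1 Ep2]; apply: riesz_kernel_ge => //; exact: ED.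
apply: le_trans (ereal_inf_lbound _) _; first by exists nu.
rewrite -(leeD2rE (x := b%:E))//.
rewrite -(integral_shift mEE (supported_measure2 cE nuE) _ b0 KD); last first.
  exact: measurable_funTS.
pose Psi (p : borel R n * borel R n) := (psi p.1, psi p.2).
have mPsi : measurable_fun setT Psi.
  by apply: measurable_fun_pair; apply: measurableT_comp.
pose m : {measure set (borel R n * borel R n) -> \bar R} :=
  measure_function_pushforward__canonical__measure_function_Measure (mu \x mu)%E mPsi.
(* The product [nu \x nu] is the image of [mu \x mu] under [Psi], since both agree on rectangles. *)
have nuPsi A : measurable A -> (nu \x nu)%E A = m A.
  apply: product_measure_unique => X Y mX mY.
  rewrite /m/= /pushforward (_ : Psi @^-1` (X `*` Y) = (psi @^-1` X) `*` (psi @^-1` Y))//.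
  rewrite product_measure1E//.
    by rewrite -[X in measurable X]setTI; apply: (mpsi).
  by rewrite -[X in measurable X]setTI; apply: (mpsi).
have mKb : measurable_fun (BE `*` BE) (fun p => K p + b%:E)%E.
  by apply: emeasurable_funD => //; apply: measurable_funTS.
have Kb0 p : (BE `*` BE) p -> (0 <= K p + b%:E)%E.
  by move=> /KD; rewrite -leeBlDr// sub0e.
rewrite (eq_measure_integral m) => [|A mA _]; last exact: nuPsi.
rewrite ge0_integral_pushforward//; last by move=> p /set_mem; exact: Kb0.
(* [Psi] may map points outside [F * F] into [E * E]; they form part of the null set [N]. *)
pose N := (~` BF `*` setT) `|` (setT `*` ~` BF).
have mNF : measurable (~` BF) by exact: measurableC.
have muNF : mu (~` BF) = 0%E.
  by move: muF; rewrite /supported_probability/= (compact_closureE cF).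
have mN1 : measurable (~` BF `*` [set: borel R n]) by exact: measurableX.
have mN2 : measurable ([set: borel R n] `*` ~` BF) by exact: measurableX.
have muN1 : (mu \x mu)%E (~` BF `*` [set: borel R n]) = 0%E.
  by rewrite product_measure1E// [X in (X * _)%E]muNF mul0e.
have muN2 : (mu \x mu)%E ([set: borel R n] `*` ~` BF) = 0%E.
  by rewrite product_measure1E// [X in (_ * X)%E]muNF mule0.
have muN : (mu \x mu)%E N = 0%E by rewrite measureU0.
have mPre : measurable (Psi @^-1` (BE `*` BE)).
  by rewrite -[X in measurable X]setTI; apply: (mPsi).
have preN : Psi @^-1` (BE `*` BE) `\` N = BF `*` BF.
  apply/seteqP; split=> [[x y] [_ xyN]|[x y] [Fx Fy]].
    by split; apply: contrapT => nF; apply: xyN; [left|right].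
  split; first by split; exact: FE.
  by move=> [[]|[]].
have mN : measurable N by exact: measurableU.
have mKP : measurable_fun (Psi @^-1` (BE `*` BE)) ((fun p => K p + b%:E)%E \o Psi).
  by apply: (measurable_comp mEE _ mKb); [move=> _ [p pE <-]|exact: measurable_funTS].
have KP0 p : (Psi @^-1` (BE `*` BE)) p -> (0 <= ((fun p => K p + b%:E)%E \o Psi) p)%E.
  by move=> ?; exact: Kb0.
rewrite (ge0_negligible_integral mN mPre mKP KP0 muN) preN.
have KE p : (K (Psi p) = (c `^ alpha)%:E * K p + (log_shift alpha c)%:E)%E.
  exact: riesz_kernel_affine.
have lsb0 : 0 <= log_shift alpha c + b by exact: addr_ge0.
under eq_integral do rewrite /= KE -addeA -EFinD.
rewrite integral_shift//; last 3 first.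
- exact: supported_measure2.
- by apply: measurable_funTS; apply: measurable_funeM.
- move=> p [Fp1 Fp2]; have := KD (Psi p) (conj (FE _ Fp1) (FE _ Fp2)).
  rewrite KE -leeBlDr// => /(le_trans _); apply.
  by rewrite -!EFinN -EFinD lee_fin; lra.
rewrite EFinD addeA; apply: leeD2r; apply: leeD2r; rewrite -/K.
rewrite le_eqVlt; apply/orP; left; apply/eqP.
(* For [alpha = 0] the kernel may change sign but the factor is 1; otherwise the kernel is
   nonnegative. *)
have [az|a1] := eqVneq alpha 0.
  by rewrite az powRr0 mul1e; apply: eq_integral => p _; rewrite mul1e /K az.
apply: ge0_integralZl_EFin => //.
- move=> p _; rewrite /K riesz_kernelE /riesz_profile (negbTE a1).
  by case: ifP => // _; rewrite lee_fin powR_ge0.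
- exact: measurable_funTS.
- exact: ltW.
Qed.

End energy.

(** * Blaschke selection *)

(** [E] is the limit of the [G k] along an ultrafilter; the common ball of radius [r] turns
    Hausdorff closeness into inclusions up to the factor [c]. *)
Lemma blaschke_selection (R : realType) n (G : nat -> set 'rV[R]_n) (r M : R) :
  0 < r -> (forall k, convex_set (G k)) ->
  (forall k z, `|z| <= r -> G k z) -> (forall k x, G k x -> `|x| <= M) ->
  exists E : set 'rV[R]_n, [/\ compact E, convex_set E, forall z, `|z| <= r -> E z &
    forall c k0, 1 < c -> exists k, [/\ (k0 <= k)%N,
      forall x, G k x -> E (c^-1 *: x) & forall x, E x -> G k (c^-1 *: x)]].
Proof.
move=> r0 xG rG GM.
have [U [UU ooU]] := ultraFilterLemma eventually_filter.
have FU : ProperFilter U by exact: ultra_proper.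
pose near_ k (x : 'rV[R]_n) e := exists2 y, G k y & `|x - y| < e.
pose E := [set x | forall e, 0 < e -> U [set k | near_ k x e]].
have rE z : `|z| <= r -> E z.
  move=> zr e e0; apply: filterS filterT => k _.
  by exists z; [exact: rG|rewrite subrr normr0].
have EM x : E x -> `|x| <= M + 1.
  move=> Ex; have [k [y Gy xy]] := filter_ex (Ex 1 ltr01).
  rewrite -(subrK y x) addrC (le_trans (ler_normD _ _))// lerD//; last exact: ltW.
  exact: GM Gy.
have clE : closed E.
  move=> x /closureP clx e e0; have e2 : 0 < e / 2 by exact: divr_gt0.
  have [x' Ex' xx'] := clx _ e2.
  apply: filterS (Ex' _ e2) => k [y Gy xy]; exists y => //.
  rewrite -(subrKA x') (le_lt_trans (ler_normD _ _))//.
  by rewrite [ltRHS](splitr e) ltrD.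
have cE : compact E.
  apply: bounded_closed_compact clE.
  exists (M + 1); split; first exact: num_real.
  by move=> b Mb x Ex; exact: le_trans (EM x Ex) (ltW Mb).
have xE : convex_set E.
  apply/convex_setP => x y t Ex Ey /andP[t0 t1] e e0.
  apply: filterS2 (Ex _ e0) (Ey _ e0) => k [x' Gx' xx'] [y' Gy' yy'].
  exists ((1 - t) *: x' + t *: y').
    by have /convex_setP := xG k; apply=> //; rewrite t0.
  rewrite opprD addrACA -!scalerBr (le_lt_trans (ler_normD _ _))// !normrZ.
  rewrite (ger0_norm t0) ger0_norm ?subr_ge0//.
  by have [->|tn0] := eqVneq t 0; [lra|have tp : 0 < t by [rewrite lt_def tn0]; nra].
(* Along [U], any choice of points in a compact set clusters. *)
have cluster_pt (A : set 'rV[R]_n) (bad : set nat) (pt : nat -> 'rV[R]_n) :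
    compact A -> U bad -> (forall k, bad k -> A (pt k)) ->
    exists2 p, A p & forall e S, 0 < e -> U S ->
      exists k, [/\ S k, bad k & `|p - pt k| < e].
  move=> cA Ub Apt.
  have PF : ProperFilter (pt @ U) by exact: fmap_proper_filter.
  have [|p [Ap clp]] := cA _ PF.
    have : U (pt @^-1` A) by apply: filterS Ub; exact: Apt.
    exact.
  exists p => // e S e0 US.
  have [|_ [[k [Sk bk] <-] pk]] := clp (pt @` (S `&` bad)) (ball p e) _ (nbhsx_ballx p _ e0).
    have : U (pt @^-1` (pt @` (S `&` bad))).
      by apply: filterS (filterI US Ub) => k SB; exists k.
    exact.
  by exists k; split=> //; move: pk; rewrite -ball_normE.
(* Otherwise, for [U]-many [k], some point of [G k] is at distance at least [e] from [E]; a cluster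
   point of these would lie in [E]. *)
have GE e : 0 < e -> U [set k | forall x, G k x -> exists2 y, E y & `|x - y| < e].
  move=> e0; have [//|Ubad] := in_ultra_setVsetC
    [set k | forall x, G k x -> exists2 y, E y & `|x - y| < e] UU.
  exfalso.
  have badP k : exists x,
      (~` [set k | forall x, G k x -> exists2 y, E y & `|x - y| < e]) k ->
      G k x /\ forall y, E y -> e <= `|x - y|.
    have [H|H] := pselect (exists x, G k x /\ forall y, E y -> e <= `|x - y|).
      by case: H => x Hx; exists x.
    exists 0 => nk; exfalso; apply: nk => x Gx; apply: contrapT => nE; apply: H.
    exists x; split=> // y Ey; rewrite leNgt; apply/negP => xy; apply: nE.
    by exists y.
  pose pt k := sval (cid (badP k)).
  have ptP k : (~` [set k | forall x, G k x -> exists2 y, E y & `|x - y| < e]) k ->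
      G k (pt k) /\ forall y, E y -> e <= `|pt k - y| by exact: (svalP (cid (badP k))).
  have cM : compact [set x : 'rV[R]_n | `|x| <= M].
    apply: bounded_closed_compact.
      by exists M; split=> [|b Mb x /= xM]; [exact: num_real|exact: le_trans xM (ltW Mb)].
    move=> x /closureP clx; apply/ler_addgt0Pr => d d0.
    have [y /= yM xy] := clx d d0.
    by rewrite -(subrK y x) addrC (le_trans (ler_normD _ _))// lerD// ltW.
  have [|p _ pP] := cluster_pt _ _ pt cM Ubad.
    by move=> k /ptP[Gk _]; exact: GM Gk.
  have Ep : E p.
    move=> d d0; have [//|Uc] := in_ultra_setVsetC [set k | near_ k p d] UU.
    have [k [nk bk pk]] := pP d _ d0 Uc.
    by exfalso; apply: nk; exists (pt k) => //; case: (ptP _ bk).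
  have [k [_ bk pk]] := pP e _ e0 filterT.
  have [_ /(_ _ Ep)] := ptP _ bk.
  by rewrite distrC leNgt pk.
(* Otherwise points of [E] far from [G k] cluster at some [p] in [E], yet [p] is close to [G k] for
   [U]-many [k]. *)
have EG e : 0 < e -> U [set k | forall x, E x -> near_ k x e].
  move=> e0; have [//|Ubad] := in_ultra_setVsetC
    [set k | forall x, E x -> near_ k x e] UU.
  exfalso.
  have badP k : exists x, (~` [set k | forall x, E x -> near_ k x e]) k ->
      E x /\ ~ near_ k x e.
    have [H|H] := pselect (exists x, E x /\ ~ near_ k x e).
      by case: H => x Hx; exists x.
    exists 0 => nk; exfalso; apply: nk => x Ex; apply: contrapT => nE; apply: H.
    by exists x.
  pose pt k := sval (cid (badP k)).
  have ptP k : (~` [set k | forall x, E x -> near_ k x e]) k ->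
      E (pt k) /\ ~ near_ k (pt k) e by exact: (svalP (cid (badP k))).
  have [|p Ep pP] := cluster_pt _ _ pt cE Ubad; first by move=> k /ptP[].
  have e2 : 0 < e / 2 by exact: divr_gt0.
  have [k [[y Gy py] bk pk]] := pP _ _ e2 (Ep _ e2).
  have [_] := ptP _ bk; apply; exists y => //.
  rewrite -(subrKA p) (le_lt_trans (ler_normD _ _))// distrC.
  by rewrite [ltRHS](splitr e) ltrD.
exists E; split=> // c k0 c1; have c10 : 0 < c - 1 by rewrite subr_gt0.
have c0 : 0 < c by exact: lt_trans c1.
have e0 : 0 < r * (c - 1) by exact: mulr_gt0.
(* [x / c] is a convex combination of [y] and [(x - y) / (c - 1)], which lies in the ball of radius
   [r]. *)
have shrink (A : set 'rV[R]_n) x y : convex_set A -> (forall z, `|z| <= r -> A z) ->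
    A y -> `|x - y| < r * (c - 1) -> A (c^-1 *: x).
  move=> /convex_setP xA rA Ay xy.
  have -> : c^-1 *: x = (1 - c^-1) *: ((c - 1)^-1 *: (x - y)) + c^-1 *: y.
    by apply/rowP => i; rewrite !mxE; field; rewrite !gt_eqF.
  apply: xA => //; last by rewrite invr_ge0 ltW//= invf_le1// ltW.
  apply: rA; rewrite normrZ ger0_norm ?invr_ge0 ?(ltW c10)//.
  by rewrite mulrC ler_pdivrMr// ltW.
have Uk0 : U [set k | (k0 <= k)%N] by apply: ooU; exists k0.
have [k [[GEk EGk] kk0]] := filter_ex (filterI (filterI (GE _ e0) (EG _ e0)) Uk0).
exists k; split=> // x.
  by move=> /GEk[y Ey xy]; exact: shrink xE rE Ey xy.
by move=> /EGk[y Gy xy]; apply: shrink (xG k) _ Gy xy; exact: rG.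
Qed.

(** * Minimizers *)

(** This body serves as minimizer when the functional is infinite on all admissible bodies. *)
Lemma unit_cube (R : realType) n
    (C := [set x : 'rV[R]_n | forall i, `[0, 1]%classic (x ord0 i)]) :
  convex_body C /\ volume C = 1%E.
Proof.
have CE : C = box 0 (const_mx 1).
  by apply/seteqP; split=> x xC i; have := xC i; rewrite /= in_itv !mxE.
have prodE : \prod_(i < n) ((const_mx 1 : 'rV[R]_n) ord0 i - (0 : 'rV[R]_n) ord0 i) = 1.
  by rewrite big1// => i _; rewrite !mxE subr0.
have ord01 i : (0 : 'rV[R]_n) ord0 i <= (const_mx 1 : 'rV[R]_n) ord0 i.
  by rewrite !mxE.
split; last first.
  apply/eqP; rewrite eq_le -{1 2}prodE CE.
  by rewrite volume_le_box// box_le_volume.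
split.
- exact: (@rV_compact R n (fun=> `[0, 1]%classic) (fun=> @segment_compact R 0 1)).
- apply/convex_setP => x y t; rewrite CE => xC yC /andP[t0 t1] i.
  by move: (xC i) (yC i); rewrite !mxE => /andP[? ?] /andP[? ?]; apply/andP; split; nra.
- exists (const_mx 2^-1); apply/interiorP; exists 2^-1 => // y yC; rewrite CE => i.
  have := le_lt_trans (entry_le_norm _ i) yC.
  by rewrite !mxE ltr_norml => /andP[? ?]; apply/andP; split; lra.
Qed.

(** The energy is bounded below by a quantity that decreases only logarithmically in the perimeter,
    so the perimeter is bounded first; the other bounds follow from it. *)
Lemma sublevel_bounds (R : realType) n (alpha Q : R) (m : R) : 0 <= alpha -> 0 < Q ->
  exists h M B p, 0 < h /\ forall F : set 'rV[R]_n.+1,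
    convex_body F -> volume F = 1%E -> (functional alpha Q F <= m%:E)%E ->
    exists x0 P e, [/\ perimeter F = P%:E, energy alpha F = e%:E,
      0 <= P <= p & - B <= e] /\
      ((forall z, `|z| <= h -> F (x0 + z)) /\ forall q, F q -> `|q - x0| <= M).
Proof.
move=> a0 Q0; have [c /andP[c0 c1] cubeP] := @inscribed_cube R n.
have Q20 : 0 < Q ^+ 2 by rewrite exprn_gt0.
have N0 : 0 < n.+1%:R :> R by rewrite ltr0n.
(* [K + n.+1 * ln p'] is the logarithm of the diameter bound when the perimeter is at most [p']. *)
pose K := ln (8 * n.+1%:R * c ^- n.+1).
(* By [ln (ep * p') <= ep * p'], the term [n.+1 * Q ^+ 2 * ln p'] is at most [p' / 2] plus a
   constant; [p] solves the resulting linear inequality. *)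
pose ep := (2 * n.+1%:R * Q ^+ 2)^-1; have ep0 : 0 < ep by rewrite invr_gt0 !mulr_gt0.
pose p := Num.max 1 (2 * (m + 1 + Q ^+ 2 * K - n.+1%:R * Q ^+ 2 * ln ep)).
have p1 : 1 <= p by rewrite le_max lexx.
have p0 : 0 < p by exact: lt_le_trans p1.
have size (F : set 'rV[R]_n.+1) p' : convex_body F -> volume F = 1%E -> 1 <= p' ->
    (perimeter F <= p'%:E)%E ->
    (- (K + n.+1%:R * ln p')%:E <= energy alpha F)%E /\ exists x0,
      ((forall z, `|z| <= c / p' -> F (x0 + z)) /\
       forall q, F q -> `|q - x0| <= 4 * (c / p') ^- n.+1).
  move=> [cF xF _] vF p'1 FP; have p'0 : 0 < p' by exact: lt_le_trans p'1.
  have [x0 x0P] := cubeP F p' cF xF vF p'1 FP.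
  have h01 : 0 < c / p' <= 1.
    by rewrite divr_gt0//= ler_pdivrMr// mul1r (le_trans c1).
  have MP := le_norm_of_inscribed_cube xF vF h01 x0P.
  split; last by exists x0.
  have cn1 : 1 <= c ^- n.+1 by rewrite invf_ge1 ?exprn_gt0// exprn_ile1// ltW.
  have pn1 : 1 <= p' ^+ n.+1 by rewrite exprn_ege1.
  have n1 : 1 <= n.+1%:R :> R by rewrite ler1n.
  have -> : K + n.+1%:R * ln p' = ln (8 * n.+1%:R * c ^- n.+1 * p' ^+ n.+1).
    rewrite [in RHS]lnM ?posrE ?mulr_gt0 ?invr_gt0 ?exprn_gt0//.
    by rewrite lnXn// mulr_natl.
  apply: energy_ge => //.
    have : 1 <= c ^- n.+1 * p' ^+ n.+1 by nra.
    by rewrite -mulrA; nra.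
  move=> x y Fx Fy; apply: le_trans (enorm_le_norm _) _.
  have -> : 8 * n.+1%:R * c ^- n.+1 * p' ^+ n.+1 =
      n.+1%:R * (4 * (c / p') ^- n.+1 + 4 * (c / p') ^- n.+1).
    by rewrite expr_div_n invf_div; ring.
  rewrite ler_wpM2l// -(subrKA x0) (le_trans (ler_normD _ _))// lerD ?MP//.
  by rewrite distrC MP.
exists (c / p), (4 * (c / p) ^- n.+1), (K + n.+1%:R * ln p), p.
split=> [|F bF vF Fm]; first exact: divr_gt0.
have P0 : (0 <= perimeter F)%E by exact: hausdorff_measure_ge0.
(* With energy different from [-oo], a finite bound on the functional makes both terms finite. *)
have eNy : energy alpha F != -oo%E.
  have [cF _ _] := bF; have [M M0 MF] := compact_normP cF.
  have : (- (ln (1 + n.+1%:R * (M + M)))%:E <= energy alpha F)%E.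
    apply: energy_ge => //; first by rewrite lerDl mulr_ge0// addr_ge0// ltW.
    move=> x y Fx Fy; apply: le_trans (enorm_le_norm _) _.
    rewrite (@le_trans _ _ (n.+1%:R * (M + M))) ?lerDr//.
    by rewrite ler_wpM2l// (le_trans (ler_normB _ _))// lerD// MF.
  by case: (energy alpha F).
have [P PE] : exists P, perimeter F = P%:E.
  move: Fm P0; rewrite /functional; case: (perimeter F) => [P _ _|Fm _|//].
    by exists P.
  move: Fm eNy; case: (energy alpha F) => [e| |]// Fm _.
  by move: Fm; rewrite gt0_muley.
have [e eE] : exists e, energy alpha F = e%:E.
  move: Fm eNy; rewrite /functional PE; case: (energy alpha F) => [e _ _|Fm _|//].
    by exists e.
  by move: Fm; rewrite gt0_muley// addey.
move: Fm P0; rewrite /functional PE eE -EFinM -EFinD !lee_fin => Fm P0.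
have Pp : P <= p.
  pose p' := Num.max 1 P.
  have p'1 : 1 <= p' by rewrite le_max lexx.
  have p'0 : 0 < p' by exact: lt_le_trans p'1.
  have [|+ _] := size F p' bF vF p'1; first by rewrite PE lee_fin le_max lexx orbT.
  rewrite eE -EFinN lee_fin => elb.
  have p'P : p' <= P + 1 by rewrite ge_max; apply/andP; split; lra.
  have lnp' : n.+1%:R * Q ^+ 2 * ln p' <= p' / 2 - n.+1%:R * Q ^+ 2 * ln ep.
    have : ln (ep * p') <= ep * p' by rewrite ltW// ln_sublinear// mulr_gt0.
    rewrite lnM// -(ler_pM2l (x := n.+1%:R * Q ^+ 2)) ?mulr_gt0// mulrDr.
    have -> : n.+1%:R * Q ^+ 2 * (ep * p') = p' / 2.
      by rewrite /ep; field; rewrite !gt_eqF.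
    lra.
  apply: (@le_trans _ _ p'); first by rewrite le_max lexx orbT.
  rewrite /p le_max; apply/orP; right.
  have : - (Q ^+ 2 * K + n.+1%:R * Q ^+ 2 * ln p') <= Q ^+ 2 * e.
    by move: elb; rewrite -(ler_pM2l Q20); lra.
  lra.
have [elb [x0 [cube MP]]] := size F p bF vF p1 ltac:(by rewrite PE lee_fin).
exists x0, P, e; split; first by split=> //;
  [rewrite P0|move: elb; rewrite eE -EFinN lee_fin].
by split.
Qed.

(** Used to let the dilation factor [c] decrease to 1 in the comparison inequalities. *)
Lemma le_right_limit (R : realType) (a : \bar R) (f : R -> R) :
  continuous f -> (forall c, 1 < c -> (a <= (f c)%:E)%E) -> (a <= (f 1)%:E)%E.
Proof.
move=> cf; case: a => [a| |] af; last exact: leNye.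
  rewrite lee_fin leNgt; apply/negP => fa.
  have /cvgr_lt /(_ _ fa) := cf 1 => /nbhs_ballP[e /= e0 fe].
  have : f (1 + e / 2) < a.
    apply: fe; rewrite -ball_normE/= opprD addrA subrr sub0r normrN.
    by rewrite gtr0_norm ?divr_gt0//; lra.
  have : 1 < 1 + e / 2 by rewrite ltrDl divr_gt0.
  by move=> /af; rewrite lee_fin leNgt => /negP.
have : 1 < 2 :> R by lra.
by move=> /af.
Qed.

Lemma minimizer_exists (R : realType) n (alpha Q : R) :
  0 <= alpha < n.+1%:R -> 0 < Q ->
  exists E : set 'rV[R]_n.+1,
    [/\ convex_body E, volume E = 1%E &
      forall F : set 'rV[R]_n.+1, convex_body F -> volume F = 1%E ->
        (functional alpha Q E <= functional alpha Q F)%E].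
Proof.
move=> /andP[a0 aN] Q0; have Q20 : 0 < Q ^+ 2 by rewrite exprn_gt0.
pose adm (F : set 'rV[R]_n.+1) := convex_body F /\ volume F = 1%E.
have [[F0 [admF0 F0fin]]|allinfty] :=
    pselect (exists F, adm F /\ (functional alpha Q F < +oo)%E); last first.
  have [bC vC] := unit_cube R n.+1.
  exists [set x | forall i, `[0, 1]%classic (x ord0 i)].
  split=> [||F bF vF]; [exact: bC|exact: vC|].
  suff -> : functional alpha Q F = +oo%E by exact: leey.
  apply/eqP; rewrite -leye_eq leNgt; apply/negP => Ffin.
  by apply: allinfty; exists F.
pose I := ereal_inf [set functional alpha Q F | F in adm].
have I_le F : adm F -> (I <= functional alpha Q F)%E.
  by move=> admF; apply: ereal_inf_lbound; exists F.
have [i IE] : exists i, I = i%:E.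
  have [m F0m] : exists m, (functional alpha Q F0 <= m%:E)%E.
    move: F0fin; case: (functional alpha Q F0) => [r _|/=|_].
    - by exists r.
    - by rewrite ltxx.
    - by exists 0; exact: leNye.
  have [h [M [B [p [_ bd]]]]] := @sublevel_bounds R n alpha Q m a0 Q0.
  (* The functional either exceeds [m] or is at least [- (Q ^+ 2 * B)], so its infimum is finite. *)
  have : ((Num.min m (- (Q ^+ 2 * B)))%:E <= I)%E.
    apply: le_ereal_inf_tmp => _ [F [bF vF] <-].
    have [Fm|/ltW mF] := leP (functional alpha Q F) m%:E; last first.
      by apply: le_trans mF; rewrite lee_fin ge_min lexx.
    have [x0 [P [e [[PE eE /andP[P0 _] Be] _]]]] := bd F bF vF Fm.
    rewrite /functional PE eE -EFinM -EFinD lee_fin ge_min; apply/orP; right.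
    by move: Be; rewrite -(ler_pM2l Q20); lra.
  have := le_trans (I_le _ admF0) F0m.
  by case: (I) => [r _ _| |]//; exists r.
have [h [M [B [p [h0 bd]]]]] := @sublevel_bounds R n alpha Q (i + 1) a0 Q0.
have seqP k : exists F, adm F /\ (functional alpha Q F <= (i + k.+1%:R^-1)%:E)%E.
  have k0 : 0 < k.+1%:R^-1 :> R by rewrite invr_gt0 ltr0n.
  have : (I < (i + k.+1%:R^-1)%:E)%E by rewrite IE lte_fin ltrDl.
  move=> /ereal_inf_lt[_ [F admF <-] /ltW FI].
  by exists F.
pose F k := sval (cid (seqP k)).
have admF k : adm (F k) by case: (svalP (cid (seqP k))).
have FI k : (functional alpha Q (F k) <= (i + k.+1%:R^-1)%:E)%E.
  by case: (svalP (cid (seqP k))).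
have bdF k : exists x0 P e, [/\ perimeter (F k) = P%:E, energy alpha (F k) = e%:E,
      0 <= P <= p & - B <= e] /\
      ((forall z, `|z| <= h -> F k (x0 + z)) /\ forall q, F k q -> `|q - x0| <= M).
  have [bF vF] := admF k; apply: bd => //; apply: le_trans (FI k) _.
  by rewrite lee_fin lerD2l invf_le1// ler1n.
pose x k := sval (cid (bdF k)).
have xP k : exists P e, [/\ perimeter (F k) = P%:E, energy alpha (F k) = e%:E,
      0 <= P <= p & - B <= e] /\
      ((forall z, `|z| <= h -> F k (x k + z)) /\ forall q, F k q -> `|q - x k| <= M).
  exact: (svalP (cid (bdF k))).
(* Translation centers the inscribed cubes at the origin. *)
pose G k := [set y | F k (x k + y)].
have [|k z zh|k y Gy|E [cE xE hE EG]] := @blaschke_selection R n.+1 G h M h0.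
- move=> k; apply/convex_setP => y z t Gy Gz t01.
  have [[_ /convex_setP xF _] _] := admF k.
  rewrite /G/= (_ : _ + _ = (1 - t) *: (x k + y) + t *: (x k + z)); first exact: xF.
  by apply/rowP => j; rewrite !mxE; ring.
- by have [P [e [_ [/(_ z zh)]]]] := xP k.
- by have [P [e [_ [_ /(_ _ Gy)]]]] := xP k; rewrite addrAC subrr add0r.
have E0 : E !=set0 by exists 0; apply: hE; rewrite normr0 ltW.
have EF c k : 1 < c -> (forall y, E y -> G k (c^-1 *: y)) ->
    forall y, E y -> F k (c^-1 *: y + x k).
  by move=> c1 H y /H; rewrite /G/= addrC.
have FE c k : (forall y, G k y -> E (c^-1 *: y)) ->
    forall y, F k y -> E (c^-1 *: (y - x k)).
  by move=> H y Fy; apply: H; rewrite /G/= addrC subrK.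
have powC m : continuous (fun c : R => c ^+ m) by exact: exprn_continuous.
(* Each of [E] and [F k] lies in a translate of [c] times the other; [c] then tends to 1. *)
have vE : volume E = 1%E.
  have vle : (volume E <= 1)%E.
    rewrite -[1%E]/((1 : R)%:E) -(expr1n R n.+1).
    apply: (@le_right_limit R _ (fun c => c ^+ n.+1)) => // c c1.
    have c0 : 0 < c by exact: lt_trans c1.
    have [k [_ _ EGk]] := EG c 0%N c1; have [_ vF] := admF k.
    rewrite -[leRHS]mule1 -vF; apply: (@volume_affine _ _ c (- (c *: x k))) => // y Ey.
    rewrite opprK scalerDr scalerA mulVf ?gt_eqF// scale1r.
    exact: EF.
  apply/eqP; rewrite eq_le vle/=.
  have vfin : volume E \is a fin_num.
    by rewrite ge0_fin_numE ?volume_ge0// (le_lt_trans vle)// ltry.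
  rewrite -(fineK vfin) -[leRHS]mul1e -[X in (X%:E * _)%E](expr1n R n.+1) -EFinM.
  apply: (@le_right_limit R _ (fun c => c ^+ n.+1 * fine (volume E))) => [|c c1].
    by move=> c; exact: (cvgM (powC _ c) (@cvg_cst _ (fine (volume E)) _ (nbhs c) _)).
  have c0 : 0 < c by exact: lt_trans c1.
  have [k [_ GEk _]] := EG c 0%N c1; have [_ vF] := admF k.
  by rewrite EFinM (fineK vfin) -vF; apply: (volume_affine c0); exact: FE GEk.
have bE : convex_body E.
  split=> //; exists 0; apply/interiorP; exists h => // y.
  by rewrite sub0r normrN => /ltW; exact: hE.
exists E; split=> [||F' bF' vF']; [exact: bE|exact: vE|]; apply: le_trans (I_le F' (conj bF' vF')).
pose b := Num.max 0 ((i + 1) / Q ^+ 2).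
have b0 : 0 <= b by rewrite le_max lexx.
pose f c : R := i + (c - 1) + (c ^+ n - 1) * p + Q ^+ 2 * ((c ^+ n.+1 - 1) * b + (c - 1)).
have f1 : f 1 = i by rewrite /f !expr1n; ring.
rewrite IE -f1; apply: le_right_limit.
  pose q : {poly R} := i%:P + ('X - 1%:P) + ('X ^+ n - 1%:P) * p%:P +
    (Q ^+ 2)%:P * (('X ^+ n.+1 - 1%:P) * b%:P + ('X - 1%:P)).
  have -> : f = horner q.
    by apply/funext => c; rewrite /f /q !hornerE.
  exact: continuous_horner.
move=> c c1; have c0 : 0 < c by exact: lt_trans c1.
have d0 : 0 < c - 1 by rewrite subr_gt0.
(* This lower bound on [k] makes the minimizing error [1 / (k + 1)] at most [c - 1]. *)
have [k [kc GEk EGk]] := EG c (Num.truncn (c - 1)^-1) c1.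
have kc' : k.+1%:R^-1 <= c - 1.
  rewrite -[leRHS]invrK lef_pV2 ?posrE ?invr_gt0// ltW//.
  by apply: (lt_le_trans (truncnS_gt _)); rewrite ler_nat ltnS.
have [P [e [[PE eE /andP[P0 Pp] _] _]]] := xP k.
have [[cF xF _] _] := admF k.
have ineqP : (perimeter E <= (c ^+ n * P)%:E)%E.
  have := @perimeter_affine _ _ E (F k) c^-1 (x k) cE xE E0 cF.
  rewrite invrK PE -EFinM; apply; first by rewrite invr_gt0.
  exact: EF.
have ca1 : 1 <= c `^ alpha by rewrite -(powRr0 c) ler_powR// ltW.
have caN : c `^ alpha <= c ^+ n.+1.
  by rewrite -powR_mulrn ?(ltW c0)// ler_powR ?(ltW c1)// ltW.
have ls : log_shift alpha c <= c - 1.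
  rewrite /log_shift; case: ifP => _; last exact: ltW.
  have := @le_ln1Dx R (c - 1); rewrite addrCA subrr addr0; apply.
  by rewrite ltrBrDr; lra.
have ineqe : (energy alpha E <= (c `^ alpha * e + (c - 1))%:E)%E.
  apply: (le_trans (energy_affine cE cF a0 (ltW c1) (FE _ _ GEk))).
  by rewrite eE -EFinM -EFinD lee_fin lerD2l.
have := FI k; rewrite /functional PE eE -EFinM -EFinD lee_fin => FkI.
have eb : e <= b.
  rewrite le_max; apply/orP; right; rewrite ler_pdivlMr// mulrC.
  have k1 : k.+1%:R^-1 <= 1 :> R by rewrite invf_le1// ler1n.
  apply: (@le_trans _ _ (P + Q ^+ 2 * e)); first by rewrite lerDr.
  by apply: (le_trans FkI); rewrite lerD2l.
have cn1 : 1 <= c ^+ n by rewrite exprn_ege1// ltW.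
have cN1 : 1 <= c ^+ n.+1 by rewrite exprn_ege1// ltW.
have H1 : (c ^+ n - 1) * P <= (c ^+ n - 1) * p by rewrite ler_wpM2l// subr_ge0.
have H2 : (c `^ alpha - 1) * e <= (c ^+ n.+1 - 1) * b.
  apply: (@le_trans _ _ ((c `^ alpha - 1) * b)).
    by rewrite ler_wpM2l// subr_ge0.
  by rewrite ler_wpM2r// lerD2r.
apply: (@le_trans _ _ ((c ^+ n * P)%:E + (Q ^+ 2)%:E * (c `^ alpha * e + (c - 1))%:E)%E).
  by apply: leeD => //; rewrite lee_pmul2l.
rewrite -EFinM -EFinD lee_fin /f.
have H3 : Q ^+ 2 * (c `^ alpha * e + (c - 1)) <=
    Q ^+ 2 * e + Q ^+ 2 * ((c ^+ n.+1 - 1) * b + (c - 1)).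
  rewrite -mulrDr ler_pM2l// [leRHS]addrA lerD2r -lerBlDl.
  by move: H2; rewrite mulrBl mul1r.
have H4 : P + Q ^+ 2 * e <= i + (c - 1) by apply: (le_trans FkI); rewrite lerD2l.
have -> : c ^+ n * P = (c ^+ n - 1) * P + P by ring.
move: H1 H3 H4; clear; move: (_ * P) (_ * p) (Q ^+ 2 * e) => A A' Y.
move: (Q ^+ 2 * _) (Q ^+ 2 * _) => X Z.
lra.
Qed.

Theorem theorem1p1 (R : realType) (N : nat) (hN : (2 <= N)%N)
    (alpha : R) (halpha : 0 <= alpha < N%:R) (Q : R) (hQ : 0 < Q) :
  exists E : set 'rV[R]_N,
    [/\ convex_body E, volume E = 1%E &
      forall F : set 'rV[R]_N, convex_body F -> volume F = 1%E ->
        (functional alpha Q E <= functional alpha Q F)%E].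
Proof.
by case: N hN halpha => [//|n] _ halpha; exact: minimizer_exists.
Qed.
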